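(* For $\gamma>0$ and $\delta\in(0,1)$ let $\rho_{\gamma}(\delta)=\dfrac{1}{\gamma\log(\delta^{-1})}$, and for constants $c_u,c_l$ define $$\widetilde{\mathcal{U}}^{\gamma}(\delta,\rho_{\gamma}(\delta))=\sqrt{2\rho_{\gamma}(\delta)\log\left(\frac{1}{\delta^2\rho_{\gamma}^3(\delta)}\right)+6\rho_{\gamma}(\delta)}+c_u\left[2\rho_{\gamma}(\delta)\log\left(\frac{1}{\delta^2\rho_{\gamma}^3(\delta)}\right)+6\rho_{\gamma}(\delta)\right],$$ $$\widetilde{\mathcal{L}}^{\gamma}(\delta,\rho_{\gamma}(\delta))=\sqrt{2\rho_{\gamma}(\delta)\log\left(\frac{1}{\delta^2\rho_{\gamma}^3(\delta)}\right)+6\rho_{\gamma}(\delta)}-c_l\left[2\rho_{\gamma}(\delta)\log\left(\frac{1}{\delta^2\rho_{\gamma}^3(\delta)}\right)+6\rho_{\gamma}(\delta)\right].$$ Fix $c_u>1/3$ and $c_l<1/3$. There is a constant $\gamma_0\ge4$ such that for every fixed $\gamma>\gamma_0$ and $\epsilon>0$ there exists $\delta_0>0$ for which the following holds. In the limit where $n/N\to\delta\in(0,\delta_0)$ and $k/n\to\rho_{\gamma}(\delta)$ as $n\to\infty$, let each $n\times N$ matrix $A$ be sampled with i.i.d. entries from the Gaussian distribution $\mathcal{N}(0,1/n)$. Then $$\mathrm{Prob}\left(L(k,n,N;A)<\widetilde{\mathcal{L}}^{\gamma}(\delta,\rho_{\gamma}(\delta))+\epsilon\right)\to1\quad\text{and}\quad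 \mathrm{Prob}\left(U(k,n,N;A)<\widetilde{\mathcal{U}}^{\gamma}(\delta,\rho_{\gamma}(\delta))+\epsilon\right)\to1$$ exponentially in $n$.
   Context: Let $\chi^N(k)$ denote the set of vectors in $\mathbb{R}^N$ with at most $k$ nonzero entries. The lower and upper restricted isometry constants of an $n\times N$ matrix $A$ are $$L(k,n,N;A):=1-\min_{x\in\chi^N(k),\,x\ne0}\frac{\|Ax\|_2^2}{\|x\|_2^2},\qquad U(k,n,N;A):=\max_{x\in\chi^N(k),\,x\ne0}\frac{\|Ax\|_2^2}{\|x\|_2^2}-1.$$ Limits are along sequences of positive integer triples $(k,n,N)$ with $k\le n\le N$. The superscript $\gamma$ in $\widetilde{\mathcal{U}}^{\gamma},\widetilde{\mathcal{L}}^{\gamma}$ is only a label, not an exponent; $\rho_\gamma^3(\delta)$ means $(\rho_\gamma(\delta))^3$. $\log$ is the natural logarithm. ''A probability converges to $1$ exponentially in $n$'' means that one minus the probability is bounded by a function decaying exponentially to zero in $n$. *)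

(* Defs.v *)
From HB Require Import structures.
From mathcomp Require Import all_boot all_order all_algebra.
From mathcomp Require Import all_classical all_reals all_analysis.

Set Implicit Arguments.
Unset Strict Implicit.
Unset Printing Implicit Defensive.

Import Order.TTheory GRing.Theory Num.Theory.
Import numFieldNormedType.Exports.

Local Open Scope classical_set_scope.
Local Open Scope ring_scope.

Section RestrictedIsometry.
Context {R : realType}.

Definition norm2 {m} (x : 'cV[R]_m) : R := Num.sqrt (\sum_(i < m) x i ord0 ^+ 2).

Definition chi {N} (k : nat) : set 'cV[R]_N :=
  [set x : 'cV[R]_N | (#|[pred i | (x i ord0 != 0)%R]| <= k)%N].

Definition rayleigh_quotients (k : nat) {n N} (A : 'M[R]_(n, N)) : set R :=
  [set norm2 (A *m x) ^+ 2 / norm2 x ^+ 2 | x in chi k `&` [set x | x != 0]].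

(* For 0 < k and 0 < N the inf and the sup below are the min and the max: see
   rayleigh_quotients_min and rayleigh_quotients_max. *)
Definition ric_lower (k : nat) {n N} (A : 'M[R]_(n, N)) : R :=
  1 - inf (rayleigh_quotients k A).

Definition ric_upper (k : nat) {n N} (A : 'M[R]_(n, N)) : R :=
  sup (rayleigh_quotients k A) - 1.

Lemma norm2_sqr {m} (x : 'cV[R]_m) : norm2 x ^+ 2 = \sum_(i < m) x i ord0 ^+ 2.
Proof. by rewrite sqr_sqrtr// sumr_ge0// => i _; rewrite sqr_ge0. Qed.

Lemma norm2_sqr_gt0 {m} (x : 'cV[R]_m) : x != 0 -> 0 < norm2 x ^+ 2.
Proof.
move=> x0; rewrite lt_neqAle sqr_ge0 andbT norm2_sqr.
apply: contra x0; rewrite eq_sym psumr_eq0 => [/allP h|i _]; last exact: sqr_ge0.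
apply/eqP/colP => i; rewrite mxE; apply/eqP.
by have := h i (mem_index_enum i); rewrite sqrf_eq0.
Qed.

Lemma norm2Z_sqr {m} (a : R) (x : 'cV[R]_m) :
  norm2 (a *: x) ^+ 2 = a ^+ 2 * norm2 x ^+ 2.
Proof.
rewrite !norm2_sqr mulr_sumr; apply: eq_bigr => i _.
by rewrite !mxE exprMn.
Qed.

Definition sparse_sphere {N} k : set 'rV[R]_N :=
  [set v : 'rV[R]_N | \sum_(i < N) v ord0 i ^+ 2 = 1 /\ chi k v^T].

Lemma continuous_sum_sqr N (I : finType) (f : I -> 'rV[R]_N -> R) :
  (forall i, continuous (f i)) -> continuous (fun v => \sum_i f i v ^+ 2).
Proof.
move=> cf; apply: (continuous_big (op := +%R)); first exact: add_continuous.
move=> i _ v; apply: (@continuous_comp _ _ _ (f i) (fun x : R => x ^+ 2)).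
  exact: cf.
exact: exprn_continuous.
Qed.

Lemma coord_row_continuous N i : continuous (fun v : 'rV[R]_N => v ord0 i).
Proof. by move=> v; exact: coord_continuous. Qed.

Lemma compact_sparse_sphere N k : compact (@sparse_sphere N k).
Proof.
apply: bounded_closed_compact.
  exists 1; split; [exact: num_real | move=> M M1 v [v1 _]].
  rewrite /= /Num.Def.normr /= mx_normrE; apply/bigmax_leP; split => /=.
    by rewrite (le_trans _ (ltW M1)).
  case=> i j _ /=; rewrite (ord1 i) (le_trans _ (ltW M1))//.
  rewrite -(@ler_pXn2r _ 2)// ?nnegrE// expr1n real_normK ?num_real// -v1.
  by rewrite (bigD1 j)//= lerDl sumr_ge0// => ? _; rewrite sqr_ge0.
apply: closedI.
  have /continuous_closedP :=
    continuous_sum_sqr (fun i => @coord_row_continuous N i).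
  by move=> /(_ [set 1]); apply; exact: closed_eq.
rewrite (_ : (fun _ => _) = \bigcup_(J in [set J : {set 'I_N} | (#|J| <= k)%N])
  \bigcap_(i in [set i | i \notin J]) [set v : 'rV[R]_N | v ord0 i = 0]).
  apply: closed_bigcup => [|J _]; first exact: finite_finset.
   apply: closed_bigI => i _.
  have /continuous_closedP := @coord_row_continuous N i.
  by move=> /(_ [set 0]); apply; exact: closed_eq.
apply/seteqP; split => [v /= vk|v [J /= Jk vJ]].
  exists [set i | v ord0 i != 0]%SET => /=.
    rewrite cardsE (leq_trans _ vk)// subset_leq_card//.
    by apply/fintype.subsetP => i; rewrite !inE mxE.
  by move=> i /=; rewrite inE negbK => /eqP.
rewrite /chi /= (leq_trans _ Jk)// subset_leq_card//; apply/fintype.subsetP => i.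
by rewrite inE mxE; apply: contraNT => iJ; rewrite vJ.
Qed.

Lemma rayleigh_quotientsE k n N (A : 'M[R]_(n, N)) :
  rayleigh_quotients k A = [set norm2 (A *m v^T) ^+ 2 | v in sparse_sphere k].
Proof.
apply/seteqP; split => [_ [x [xk /= x0] <-]|_ [v [v1 vk] <-]].
  have nx := norm2_sqr_gt0 x0.
  exists ((norm2 x)^-1 *: x^T).
    split; last first.
      rewrite /chi /= (leq_trans _ xk)// subset_leq_card//; apply/fintype.subsetP => i.
      by rewrite !inE !mxE mulf_eq0 negb_or => /andP[].
    rewrite -[RHS](mulfV (lt0r_neq0 nx)) [in X in X / _]norm2_sqr mulr_suml.
    by apply: eq_bigr => i _; rewrite !mxE exprMn exprVn mulrC.
  by rewrite linearZ /= trmxK -scalemxAr norm2Z_sqr exprVn mulrC.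
have v1' : norm2 v^T ^+ 2 = 1.
  by rewrite norm2_sqr -v1; apply: eq_bigr => i _; rewrite mxE.
exists v^T; last by rewrite v1' divr1.
split => //=; apply/eqP => v0; move: v1'; rewrite v0 norm2_sqr big1.
  by move/eqP; rewrite eq_sym oner_eq0.
by move=> i _; rewrite mxE expr0n.
Qed.

Lemma continuous_image n N (A : 'M[R]_(n, N)) :
  continuous (fun v : 'rV[R]_N => norm2 (A *m v^T) ^+ 2).
Proof.
rewrite (_ : (fun _ => _) =
    fun v : 'rV_N => \sum_(i < n) (\sum_(j < N) A i j * v ord0 j) ^+ 2).
  apply: continuous_sum_sqr => i; apply: (continuous_big (op := +%R)).
    exact: add_continuous.
  move=> j _ v.
  apply: (@continuous_comp _ _ _ (fun v : 'rV[R]_N => v ord0 j) ( *%R (A i j))).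
    exact: coord_row_continuous.
  exact: mulrl_continuous.
apply/funext => v; rewrite norm2_sqr; apply: eq_bigr => i _; congr (_ ^+ 2).
by rewrite mxE; apply: eq_bigr => j _; rewrite mxE.
Qed.

Lemma sparse_sphere_nonempty k N : (0 < k)%N -> (0 < N)%N -> @sparse_sphere N k !=set0.
Proof.
move=> k0; case: N => // N _; exists (delta_mx ord0 ord0); split.
  rewrite (bigD1 ord0)//= big1 ?addr0 ?mxE ?expr1n// => i /negbTE i0.
  by rewrite mxE i0 andbF expr0n.
rewrite /chi /=; apply: leq_trans k0.
rewrite -[X in (_ <= X)%N](card1 (ord0 : 'I_N.+1)) subset_leq_card//.
apply/fintype.subsetP => i; rewrite !inE !mxE /=.
by case: (i =P ord0) => //; rewrite eqxx.
Qed.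

Lemma rayleigh_quotients_min k n N (A : 'M[R]_(n, N)) :
    (0 < k)%N -> (0 < N)%N -> let Q := rayleigh_quotients k A in
  Q (inf Q) /\ lbound Q (inf Q).
Proof.
move=> k0 N0 Q; have Qlb : lbound Q 0.
  by rewrite /Q rayleigh_quotientsE => _ [v _ <-]; exact: sqr_ge0.
have [c cS cmin] := compact_EVT_min (sparse_sphere_nonempty k0 N0)
  (@compact_sparse_sphere N k) (continuous_subspaceT (@continuous_image n N A)).
have Qc : Q (norm2 (A *m c^T) ^+ 2).
  by rewrite /Q rayleigh_quotientsE; exists c => //; exact/set_mem.
have Qi : lbound Q (inf Q) by move=> x Qx; apply: ge_inf => //; exists 0.
split => //; suff -> : inf Q = norm2 (A *m c^T) ^+ 2 by [].
apply/eqP; rewrite eq_le Qi//=; apply: lb_le_inf.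
  by exists (norm2 (A *m c^T) ^+ 2).
rewrite /Q rayleigh_quotientsE => _ [v vS <-]; apply: cmin; exact/mem_set.
Qed.

Lemma rayleigh_quotients_max k n N (A : 'M[R]_(n, N)) :
    (0 < k)%N -> (0 < N)%N -> let Q := rayleigh_quotients k A in
  Q (sup Q) /\ ubound Q (sup Q).
Proof.
move=> k0 N0 Q.
have [c cS cmax] := compact_EVT_max (sparse_sphere_nonempty k0 N0)
  (@compact_sparse_sphere N k) (continuous_subspaceT (@continuous_image n N A)).
have Qc : Q (norm2 (A *m c^T) ^+ 2).
  by rewrite /Q rayleigh_quotientsE; exists c => //; exact/set_mem.
have Qub : ubound Q (norm2 (A *m c^T) ^+ 2).
  by rewrite /Q rayleigh_quotientsE => _ [v vS <-]; apply: cmax; exact/mem_set.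
suff -> : sup Q = norm2 (A *m c^T) ^+ 2 by [].
apply/eqP; rewrite eq_le; apply/andP; split.
  by apply: ge_sup => //; exists (norm2 (A *m c^T) ^+ 2).
by apply: ub_le_sup => //; exists (norm2 (A *m c^T) ^+ 2).
Qed.
End RestrictedIsometry.

Section RandomMatrices.
Context {R : realType} {d : measure_display} {T : measurableType d}.
Variable P : probability T R.

Definition mutually_independent {I : finType} (X : I -> {RV P >-> R}) : Prop :=
  forall (J : {set I}) (B : I -> set R),
    (forall i, i \in J -> measurable (B i)) ->
    P (\bigcap_(i in [set` J]) X i @^-1` B i) =
    (\prod_(i in J) P (X i @^-1` B i))%E.

(* The two measures are compared on measurable sets only: both sides are total
   functions on all sets, with meaningless values on the nonmeasurable ones.
   The second parameter of normal_prob is the standard deviation. *)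
Definition normal_rv (X : {RV P >-> R}) (m s : R) : Prop :=
  forall B : set R, measurable B -> distribution P X B = normal_prob m s B.

Definition iid_gaussian {n N} (A : 'I_n -> 'I_N -> {RV P >-> R}) : Prop :=
  mutually_independent (fun ij : 'I_n * 'I_N => A ij.1 ij.2) /\
  forall i j, normal_rv (A i j) 0 (Num.sqrt (n%:R^-1)).

Definition sample_mx {n N} (A : 'I_n -> 'I_N -> {RV P >-> R}) (w : T) :
  'M[R]_(n, N) := \matrix_(i, j) A i j w.

End RandomMatrices.

Section Bounds.
Context {R : realType}.

Definition rho (gamma delta : R) : R := 1 / (gamma * ln (delta^-1)).

Definition bound_arg (gamma delta : R) : R :=
  let r := rho gamma delta in
  2 * r * ln (1 / (delta ^+ 2 * r ^+ 3)) + 6 * r.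

Definition Utilde (cu gamma delta : R) : R :=
  Num.sqrt (bound_arg gamma delta) + cu * bound_arg gamma delta.

Definition Ltilde (cl gamma delta : R) : R :=
  Num.sqrt (bound_arg gamma delta) - cl * bound_arg gamma delta.

(* Exponential rate in n j, not in the index j of the sequence. *)
Definition cvg1_exponentially (n : nat -> nat) (p : nat -> \bar R) : Prop :=
  p j @[j --> \oo] --> 1%E /\
  exists C c : R, [/\ 0 < C, 0 < c &
    forall j, (1 - p j <= (C * expR (- (c * (n j)%:R)))%:E)%E].

End Bounds.

(* Main.v *)
Require Import Defs.
From HB Require Import structures.
From mathcomp Require Import all_boot all_order all_algebra.
From mathcomp Require Import all_classical all_reals all_analysis.
From mathcomp Require Import measurable_realfun ring lra.

Set Implicit Arguments.
Unset Strict Implicit.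
Unset Printing Implicit Defensive.

Import Order.TTheory GRing.Theory Num.Theory.
Import numFieldNormedType.Exports.

Local Open Scope classical_set_scope.
Local Open Scope ring_scope.

(** Why the theorem is true.  For a fixed vector [z] and a Gaussian matrix [A]
    with entries of variance [1/n], the number [n * |A z|^2 / |z|^2] is a
    chi-square variable with [n] degrees of freedom, so both tails
    [|A z|^2 >= v |z|^2] for [v > 1] and [|A z|^2 <= v |z|^2] for [v < 1] have
    probability at most [exp (- (n/2) * (v - 1 - ln v))]
    ([gaussian_norm_tail]).  The restricted isometry constants are controlled
    by finitely many [z]: the integer vectors with at most [k] nonzero entries
    and with [l1]-norm at most [k q] form, after scaling, a [1/q]-net of the
    [k]-sparse unit sphere ([net_approx]), and there are at most
    [exp (k * (ln (N/k) + q ln 2 + 2))] of them ([card_net]).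

    A union bound therefore succeeds as soon as
    [rho * (ln (1/(delta rho)) + C_q) < (v - 1 - ln v) / 2].  Along the curve
    [rho = 1/(gamma ln (1/delta))] the product [rho * ln (1/delta)] is frozen
    at [1/gamma] while [rho] and [rho * ln (1/rho)] vanish with [delta].
    Hence the left-hand side tends to [1/gamma], whatever the resolution [q]
    ([small_delta]): refining the net costs nothing in the limit, and this is
    why a crude net suffices for bounds as sharp as those claimed.

    For the same reason the quantity under the square root in both bounds
    decreases to [4/gamma] as [delta -> 0].  With [a = sqrt (4/gamma)] the
    bounds become [a + cu a^2] and [a - cl a^2], and the condition to check is
    [v - 1 - ln v > a^2 / 2] at [v = 1 + (a + cu a^2)] and at
    [v = 1 - (a - cl a^2)].  Since
    [v - 1 - ln v = x^2/2 - x^3/3 + O(x^4)] for [x = v - 1], these conditions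
    hold for small [a], that is for large [gamma], exactly because
    [cu > 1/3 > cl] ([chi2_rate_upper], [chi2_rate_lower]).  The slack [eps]
    pays for the discretization error, of order [1/q].

    Two technical points remain.  Independence is given on boxes only, so a
    pi-lambda argument extends it to functions of disjoint families of
    entries; the moment generating function of [|A z|^2] is then obtained by
    integrating out one entry after the other ([integral_expR_sqr_form],
    [integral_expR_rows]).  And the events are measurable because the nets of
    all resolutions together determine both constants
    ([sup_rayleigh_leP], [inf_rayleigh_geP]). *)

(** * Independence of disjoint families of random variables *)

Section Independence.
Context {R : realType} {d : measure_display} {T : measurableType d}.
Variables (P : probability T R) (I : finType) (X : I -> {RV P >-> R}).

(** The pi-system of events that prescribe, one by one, the values of the
    variables indexed by [J]; it generates the sigma-algebra of [(X i)_(i in J)]. *)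
Definition boxes (J : {set I}) : set_system T :=
  [set E | exists2 B : I -> set R, (forall i, measurable (B i)) &
    E = \bigcap_(i in [set` J]) X i @^-1` B i].

(** Measurability with respect to the sigma-algebra generated by the variables
    indexed by [J], in other words being a measurable function of them. *)
Definition adapted (J : {set I}) (U : T -> R) : Prop :=
  measurable_fun [set: g_sigma_algebraType (boxes J)] U.

Lemma measurable_boxes J : boxes J `<=` measurable.
Proof.
move=> _ [B mB ->]; apply: fin_bigcap_measurable => [|i _].
  exact: finite_finset.
by rewrite -[_ @^-1` _]setTI; apply: measurable_funP.
Qed.

Lemma measurable_sigma_boxes J : <<s boxes J >> `<=` measurable.
Proof.
apply: smallest_sub; last exact: measurable_boxes.
exact: sigma_algebra_measurable.
Qed.

Lemma boxes_setI J : setI_closed (boxes J).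
Proof.
move=> _ _ [B mB ->] [C mC ->]; exists (fun i => B i `&` C i).
  by move=> i; exact: measurableI.
by rewrite -bigcapI; apply: eq_bigcapr => i _; rewrite preimage_setI.
Qed.

(** A box on [J] is a box on [K] whose extra constraints are vacuous. *)
Lemma subset_boxes (J K : {set I}) : J \subset K -> boxes J `<=` boxes K.
Proof.
move=> /fintype.subsetP JK _ [B mB ->].
exists (fun i => if i \in J then B i else setT).
  by move=> i; case: ifP.
apply/seteqP; split => w /= h i /= iK.
  by case: ifPn => // iJ; exact: h.
by have := h i (JK i iK); rewrite /= iK.
Qed.

Lemma adaptedS (J K : {set I}) U : J \subset K -> adapted J U -> adapted K U.
Proof.
move=> JK aU _ B mB; have := aU measurableT B mB.
by apply: sub_sigma_algebra2; exact: subset_boxes.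
Qed.

Lemma adapted_measurable J U : adapted J U -> measurable_fun [set: T] U.
Proof.
by move=> aU _ B mB; apply: (@measurable_sigma_boxes J); exact: aU.
Qed.

Lemma adapted_coord (i : I) : adapted [set i] (X i).
Proof.
move=> _ B mB; rewrite setTI; apply: sub_sigma_algebra.
exists (fun=> B) => //.
by apply/seteqP; split=> w /= => [h j /=|h]; [rewrite inE => /eqP ->|apply: h; rewrite /= inE].
Qed.

(** Independence of a fixed event is stable under complements and countable
    disjoint unions, but not visibly under intersections; this is what makes
    the pi-lambda theorem necessary. *)
Lemma indep_lambda_system (F : set T) : measurable F ->
  lambda_system setT [set E | measurable E /\ (P (E `&` F) = P E * P F)%E].
Proof.
move=> mF; apply/dynkin_lambda_system; split.
- by split => //=; rewrite setTI probability_setT mul1e.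
- move=> E [mE EF]; split; first exact: measurableC.
  have -> : ~` E `&` F = F `\` (E `&` F).
    apply/seteqP; split=> w /=; first by move=> [h ?]; split=> // -[].
    by move=> [Fw h]; split=> // Ew; apply: h.
  rewrite measureD//; last 2 first.
  - exact: measurableI.
  - by rewrite ltey_eq fin_num_measure.
  rewrite [X in (_ - P X)%E](_ : _ = E `&` F); last by rewrite setIC -setIA setIid.
  rewrite probability_setC// muleBl ?mul1e -?EF//.
    by rewrite fin_num_measure.
- move=> G tG GF; split; first by apply: bigcup_measurable => k _; have [] := GF k.
  rewrite setI_bigcupl measure_bigcup//; last 2 first.
  - by move=> k _; apply: measurableI => //; have [] := GF k.
  - exact: trivIset_setIr.
  rewrite measure_bigcup//; last by move=> k _; have [] := GF k.
  have /fineK PF : P F \is a fin_num by rewrite fin_num_measure.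
  rewrite muleC -PF -nneseriesZl//; apply: eq_eseriesr => k _.
  by rewrite PF muleC; have [] := GF k.
Qed.

Hypothesis indX : mutually_independent X.

(** The intersection of a box on [J] and a box on a disjoint [K] is again a box,
    on their union, to which the product rule applies. *)
Lemma indep_boxes (J K : {set I}) E F : [disjoint J & K]%B ->
  boxes J E -> boxes K F -> P (E `&` F) = (P E * P F)%E.
Proof.
move=> dJK [B mB ->] [C mC ->].
pose D i := if i \in J then B i else C i.
have -> : \bigcap_(i in [set` J]) X i @^-1` B i `&`
          \bigcap_(i in [set` K]) X i @^-1` C i =
          \bigcap_(i in [set` (J :|: K)%SET]) X i @^-1` D i.
  apply/seteqP; split=> w /=.
    move=> [h1 h2] i /=; rewrite inE /D => /orP[iJ|iK].
      by rewrite iJ; exact: h1.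
    by rewrite (fintype.disjointFl dJK iK); exact: h2.
  move=> h; split=> i /= iJ.
    by have := h i; rewrite /= inE iJ /D iJ; apply.
  by have := h i; rewrite /= inE iJ orbT /D (fintype.disjointFl dJK iJ); apply.
rewrite !indX//; last by move=> i _; rewrite /D; case: ifP.
rewrite (eq_bigl [predU J & K]); last by move=> i; rewrite !inE.
rewrite bigU//=; congr (_ * _)%E; apply: eq_bigr => i.
  by rewrite /D => ->.
by rewrite /D => iK; rewrite (fintype.disjointFl dJK iK).
Qed.

(** Two applications of the pi-lambda theorem: the first frees the event on the
    [J] side, the second the event on the [K] side. *)
Lemma indep_sigma_boxes (J K : {set I}) E F : [disjoint J & K]%B ->
  <<s boxes J >> E -> <<s boxes K >> F -> P (E `&` F) = (P E * P F)%E.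
Proof.
move=> dJK sE sF.
have half F' : boxes K F' -> P (E `&` F') = (P E * P F')%E.
  move=> bF'; have mF' : measurable F' := measurable_boxes bF'.
  have h := lambda_system_subset (@boxes_setI J) (indep_lambda_system mF').
  have [//|//|_ //] := h _ _ E sE.
  by move=> G bG; split; [exact: measurable_boxes bG|exact: indep_boxes dJK bG bF'].
have mE : measurable E := measurable_sigma_boxes sE.
have h := lambda_system_subset (@boxes_setI K) (indep_lambda_system mE).
rewrite setIC muleC; have [//|//|_ //] := h _ _ F sF.
move=> G bG; split; first exact: measurable_boxes bG.
by rewrite setIC muleC half.
Qed.

(** The joint law of [U] and [V] is the product of their laws, by uniqueness of
    the product measure, so Tonelli integrates out [U] while [V] is frozen.  All
    moment generating functions below are computed with this single rule. *)
Lemma adapted_fubini (J K : {set I}) (U : {RV P >-> R}) (V : T -> R) (f : R * R -> \bar R) :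
    [disjoint J & K]%B -> adapted J U -> adapted K V ->
    measurable_fun setT f -> (forall x, 0 <= f x)%E ->
  (\int[P]_w f (U w, V w) =
   \int[P]_w \int[distribution P U]_u f (u, V w))%E.
Proof.
move=> dJK aU aV mf f0.
have mV := adapted_measurable aV.
have mUV : measurable_fun setT (fun w => (U w, V w)).
  by apply/measurable_fun_pairP; split; [exact: measurable_funP|exact: mV].
pose V' : {RV P >-> R} := HB.pack V (isMeasurableFun.Build _ _ _ _ _ mV).
pose UV : {RV P >-> (R * R)%type} :=
  HB.pack (fun w => (U w, V w)) (isMeasurableFun.Build _ _ _ _ _ mUV).
transitivity (\int[distribution P UV]_z f z)%E.
  by rewrite ge0_integral_distribution.
transitivity (\int[(distribution P U \x distribution P V')%E]_z f z)%E.
  apply: eq_measure_integral => A mA _; apply/esym/product_measure_unique => //.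
  move=> B C mB mC.
  transitivity (P ((U @^-1` B) `&` (V @^-1` C))) => //.
  apply: indep_sigma_boxes dJK _ _.
    by have := aU measurableT B mB; rewrite setTI.
  by have := aV measurableT C mC; rewrite setTI.
rewrite fubini_tonelli2// (ge0_integral_distribution V')//.
  exact: measurable_fun_fubini_tonelli_G.
by move=> y; exact: integral_ge0.
Qed.

End Independence.

(** * A Gaussian integral *)

Section GaussianIntegral.
Context {R : realType}.
Local Notation mu := (@lebesgue_measure R).

(** The density is the Radon-Nikodym derivative up to a null set. *)
Lemma integral_normal_prob (m s : R) (f : R -> \bar R) : s != 0 ->
    measurable_fun setT f -> (forall x, 0 <= f x)%E ->
  (\int[normal_prob m s]_x f x = \int[mu]_x (f x * (normal_pdf m s x)%:E))%E.
Proof.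
move=> s0 mf f0; have dom := normal_prob_dominates m s.
rewrite -(Radon_Nikodym_SigmaFinite.change_of_variables dom)//.
have int := Radon_Nikodym_SigmaFinite.f_integrable dom.
apply: ae_eq_integral => //.
- by apply: emeasurable_funM => //; exact: measurable_int int.
- apply: emeasurable_funM => //; apply/measurable_EFinP.
  exact: measurable_normal_pdf.
- apply: ae_eqe_mul2l; apply: integral_ae_eq => //.
  + by apply/measurable_EFinP; exact: measurable_normal_pdf.
  + by move=> E _ mE; rewrite -Radon_Nikodym_SigmaFinite.f_integral.
Qed.

Lemma complete_square (x v th a c : R) : v != 0 ->
    1 - 2 * th * (a ^+ 2 * v) != 0 ->
  let D := 1 - 2 * th * (a ^+ 2 * v) in
  th * (a * x + c) ^+ 2 + - x ^+ 2 / (v *+ 2) =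
  th / D * c ^+ 2 + - (x - 2 * th * a * c * v / D) ^+ 2 / (v / D *+ 2).
Proof. move=> v0 D0 /=; rewrite -(mulr_natr v 2) -(mulr_natr (v / _) 2).
by field; rewrite v0 D0. Qed.

(** Completing the square turns the integrand into a multiple of another normal
    density.  The shift [c] stands for the part of a linear form that has not
    been integrated yet: integrating one variable replaces the parameter [th] by
    [th / (1 - 2 th a^2 s^2)] and keeps the shape of the integrand, which is what
    makes the induction in [integral_expR_sqr_form] close. *)
Lemma integral_normal_expR_sqr (s th a c : R) : 0 < s ->
    0 < 1 - 2 * th * (a ^+ 2 * s ^+ 2) ->
  (\int[normal_prob 0 s]_x (expR (th * (a * x + c) ^+ 2))%:E =
   ((Num.sqrt (1 - 2 * th * (a ^+ 2 * s ^+ 2)))^-1 *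
    expR (th / (1 - 2 * th * (a ^+ 2 * s ^+ 2)) * c ^+ 2))%:E)%E.
Proof.
set D := 1 - _ => s0 D0.
pose s' := s / Num.sqrt D; pose m' := 2 * th * a * c * s ^+ 2 / D.
have sD0 : 0 < Num.sqrt D by rewrite sqrtr_gt0.
have s'0 : 0 < s' by rewrite divr_gt0.
have s'2 : s' ^+ 2 = s ^+ 2 / D by rewrite exprMn exprVn sqr_sqrtr// ltW.
rewrite integral_normal_prob ?gt_eqF//; last first.
  apply/measurable_EFinP/measurableT_comp => //.
  apply: measurable_funM => //; apply: measurable_funX.
  by apply: measurable_funD => //; apply: measurable_funM.
under eq_integral => x _.
  have -> : ((expR (th * (a * x + c) ^+ 2))%:E * (normal_pdf 0 s x)%:E =
      ((Num.sqrt D)^-1 * expR (th / D * c ^+ 2))%:E * (normal_pdf m' s' x)%:E)%E.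
    rewrite -!EFinM !normal_pdfE ?gt_eqF//; congr EFin.
    rewrite /normal_peak s'2.
    have -> : Num.sqrt (s ^+ 2 / D * pi *+ 2) = Num.sqrt (s ^+ 2 * pi *+ 2) / Num.sqrt D.
      have vpi : 0 <= s ^+ 2 * pi *+ 2 :> R.
        by apply: mulrn_wge0; apply: mulr_ge0; [exact: sqr_ge0|exact: pi_ge0].
      by rewrite -(sqrtrV (ltW D0)) -(sqrtrM _ vpi) mulrnAl mulrAC.
    rewrite invfM invrK; set K := (Num.sqrt (_ *+ 2))^-1.
    rewrite [LHS]mulrCA -expRD.
    transitivity (K * expR (th / D * c ^+ 2 + - (x - m') ^+ 2 / (s' ^+ 2 *+ 2))).
      congr (_ * expR _); rewrite s'2 subr0.
      by apply: complete_square; rewrite gt_eqF// exprn_gt0.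
    rewrite expRD /normal_fun s'2.
    move: (expR _) (expR _) (Num.sqrt D) sD0 K => E1 E2 r r0 K.
    by field; rewrite gt_eqF.
  over.
rewrite integralZl//=; last exact: integrable_normal_pdf.
by rewrite integral_normal_pdf mule1.
Qed.

End GaussianIntegral.

(** * Moment generating function and tails of the norm of a Gaussian image *)

Section GaussianForms.
Context {R : realType} {d : measure_display} {T : measurableType d}.
Variables (P : probability T R).

Lemma adapted_sum (I : finType) (X : I -> {RV P >-> R}) (J : {set I})
    (A : eqType) (r : seq A) (U : A -> T -> R) :
  {in r, forall i, adapted X J (U i)} ->
  adapted X J (fun w => \sum_(i <- r) U i w).
Proof.
elim: r => [|i r IH] aU.
  rewrite (_ : (fun _ => _) = cst 0); first exact: measurable_cst.
  by apply/funext => w; rewrite big_nil.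
rewrite (_ : (fun _ => _) = U i \+ (fun w => \sum_(j <- r) U j w)).
  apply: measurable_funD; first by apply: aU; rewrite mem_head.
  by apply: IH => j jr; apply: aU; rewrite inE jr orbT.
by apply/funext => w; rewrite big_cons.
Qed.

(** The law of a normal variable and the normal probability live on two
    measurable structures of the line with the same measurable sets but with
    different displays; pushing forward along the identity reconciles them. *)
Lemma integral_distribution_normal (X : {RV P >-> R}) (m s : R)
    (f : R -> \bar R) : normal_rv X m s ->
    measurable_fun setT f -> (forall x, 0 <= f x)%E ->
  (\int[distribution P X]_x f x = \int[normal_prob m s]_x f x)%E.
Proof.
move=> nX mf f0.
have mid : measurable_fun [set: measurableTypeR R] (idfun : measurableTypeR R -> R).
  by move=> _ B mB; rewrite setTI.
rewrite (eq_measure_integral (pushforward (normal_prob m s) (idfun : measurableTypeR R -> R))).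
  by rewrite ge0_integral_pushforward.
by move=> B mB _; exact: nX.
Qed.

(** This is the moment generating function of the square of a centered normal
    variable of variance [s^2 * sum a_i^2].  Removing the variables one at a
    time avoids proving that a sum of independent normal variables is normal:
    the factors [1 - 2 th a_i^2 s^2], with [th] updated at each step, telescope. *)
Lemma integral_expR_sqr_form (I : finType) (X : I -> {RV P >-> R}) (s : R)
    (a : I -> R) (r : seq I) (th : R) :
    mutually_independent X -> (forall i, normal_rv (X i) 0 s) -> 0 < s ->
    uniq r -> 0 < 1 - 2 * th * ((\sum_(i <- r) a i ^+ 2) * s ^+ 2) ->
  (\int[P]_w (expR (th * (\sum_(i <- r) a i * X i w) ^+ 2))%:E =
   ((Num.sqrt (1 - 2 * th * ((\sum_(i <- r) a i ^+ 2) * s ^+ 2)))^-1)%:E)%E.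
Proof.
move=> indX nX s0; elim: r th => [|i r IH] th.
  move=> _ _; rewrite big_nil mul0r mulr0 subr0 sqrtr1 invr1.
  under eq_integral do rewrite big_nil expr0n/= mulr0 expR0.
  by rewrite integral_cst// mul1e; exact: probability_setT.
rewrite cons_uniq !big_cons => /andP[ir ur].
set S := \sum_(j <- r) a j ^+ 2 => D0.
have S0 : 0 <= S by apply: sumr_ge0 => j _; exact: sqr_ge0.
pose D := 1 - 2 * th * (a i ^+ 2 * s ^+ 2).
have Dge : 0 < D.
  have [th0|th0] := leP 0 th.
    apply: lt_le_trans D0 _; rewrite lerD2l lerN2 ler_wpM2l ?mulr_ge0//.
    by rewrite ler_wpM2r ?sqr_ge0// lerDl.
  have : 2 * th * (a i ^+ 2 * s ^+ 2) <= 0.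
    apply: mulr_le0_ge0; last by rewrite mulr_ge0 ?sqr_ge0.
    by apply: mulr_ge0_le0 => //; exact: ltW.
  by rewrite /D; lra.
have DE : 1 - 2 * th * ((a i ^+ 2 + S) * s ^+ 2) =
    D * (1 - 2 * (th / D) * (S * s ^+ 2)).
  have Dn : D != 0 by rewrite gt_eqF.
  rewrite mulrBr mulr1 (_ : D * _ = 2 * th * (S * s ^+ 2)); last first.
    by move: (D) Dn => D1 D1n; field.
  by rewrite /D; ring.
have D'0 : 0 < 1 - 2 * (th / D) * (S * s ^+ 2).
  by move: D0; rewrite DE (pmulr_rgt0 _ Dge).
pose V w := \sum_(j <- r) a j * X j w.
pose f (x : R * R) := (expR (th * (a i * x.1 + x.2) ^+ 2))%:E.
have mf : measurable_fun setT f.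
  apply/measurable_EFinP/measurableT_comp => //; apply: measurable_funM => //.
  apply: measurable_funX; apply: measurable_funD => //.
  exact: measurable_funM.
have f0 x : (0 <= f x)%E by rewrite lee_fin expR_ge0.
have mVK : adapted X [set j in r]%SET V.
  apply: adapted_sum => j jr.
  apply: measurable_funM; first exact: measurable_cst.
  apply: (@adaptedS _ _ _ P I X [set j]%SET [set k in r]%SET (X j)); last exact: adapted_coord.
  by rewrite finset.sub1set inE.
transitivity (\int[P]_w f (X i w, V w))%E.
  by apply: eq_integral => w _; rewrite big_cons.
have dis : [disjoint [set i]%SET & [set j in r]%SET]%B by rewrite disjoints1 inE.
rewrite (adapted_fubini indX dis (@adapted_coord _ _ _ P I X i) mVK mf f0).
transitivity (\int[P]_w (((Num.sqrt D)^-1)%:E * (expR (th / D * V w ^+ 2))%:E))%E.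
  apply: eq_integral => w _.
  rewrite (integral_distribution_normal (nX i)).
  - by rewrite integral_normal_expR_sqr.
  - apply: (measurableT_comp mf); apply/measurable_fun_pairP.
    by split; [exact: measurable_id|exact: measurable_cst].
  - by move=> x; exact: f0.
rewrite ge0_integralZl//; last first.
  apply/measurable_EFinP/measurableT_comp => //; apply: measurable_funM => //.
  by apply: measurable_funX; exact: adapted_measurable mVK.
by rewrite IH// -EFinM DE sqrtrM ?(ltW Dge)// invfM.
Qed.


(** Rows of the matrix use disjoint families of entries, so their contributions
    factor. *)
Lemma integral_expR_rows (n N : nat) (A : 'I_n -> 'I_N -> {RV P >-> R})
    (s : R) (z : 'I_N -> R) (th : R) (r : seq 'I_n) :
    mutually_independent (fun ij : 'I_n * 'I_N => A ij.1 ij.2) ->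
    (forall i j, normal_rv (A i j) 0 s) -> 0 < s ->
    0 < 1 - 2 * th * ((\sum_j z j ^+ 2) * s ^+ 2) -> uniq r ->
  (\int[P]_w (expR (th * \sum_(i <- r) (\sum_j A i j w * z j) ^+ 2))%:E =
   ((Num.sqrt (1 - 2 * th * ((\sum_j z j ^+ 2) * s ^+ 2)))^-1 ^+ size r)%:E)%E.
Proof.
move=> indA nA s0; set D := 1 - _ => D0.
set X := fun ij : 'I_n * 'I_N => A ij.1 ij.2.
pose row i : seq ('I_n * 'I_N) := [seq (i, j) | j <- index_enum 'I_N].
pose Y i w := \sum_j A i j w * z j.
have YE i w : Y i w = \sum_(ij <- row i) z ij.2 * X ij w.
  by rewrite big_map; apply: eq_bigr => j _; rewrite mulrC.
have aY i : adapted X [set ij | ij.1 == i]%SET (Y i).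
  apply: adapted_sum => j _; apply: measurable_funM; last exact: measurable_cst.
  apply: (@adaptedS _ _ _ P _ X [set (i, j)]%SET _ (X (i, j))).
    by rewrite finset.sub1set inE.
  exact: adapted_coord.
have mY i : measurable_fun setT (Y i) := adapted_measurable (aY i).
have intY i : (\int[P]_w (expR (th * Y i w ^+ 2))%:E = ((Num.sqrt D)^-1)%:E)%E.
  under eq_integral do rewrite YE.
  have sz : \sum_(ij <- row i) z ij.2 ^+ 2 = \sum_j z j ^+ 2 by rewrite big_map.
  have ur : uniq (row i).
    by rewrite map_inj_uniq ?index_enum_uniq// => j k [].
  have := @integral_expR_sqr_form _ X s (fun ij => z ij.2) (row i) th indA.
  by rewrite sz; apply => // -[].
elim: r => [_|i r IH].
  under eq_integral do rewrite big_nil mulr0 expR0.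
  by rewrite integral_cst// mul1e; exact: probability_setT.
rewrite cons_uniq => /andP[ir ur].
pose V w := \sum_(k <- r) Y k w ^+ 2.
have aV : adapted X [set ij | ij.1 \in r]%SET V.
  apply: adapted_sum => k kr; apply: measurable_funX.
  apply: adaptedS (aY k); apply/fintype.subsetP => -[i' j].
  by rewrite !inE /= => /eqP ->.
have mV := adapted_measurable aV.
have dis : [disjoint [set ij : 'I_n * 'I_N | ij.1 == i]%SET &
                     [set ij : 'I_n * 'I_N | ij.1 \in r]%SET]%B.
  rewrite -setI_eq0; apply/eqP/finset.setP => -[i' j]; rewrite !inE /=.
  by apply/negP => /andP[/eqP ->]; apply/negP.
pose f (x : R * R) := (expR (th * x.2) * expR (th * x.1 ^+ 2))%:E.
have mf : measurable_fun setT f.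
  apply/measurable_EFinP; apply: measurable_funM.
    by apply/measurableT_comp => //; exact: measurable_funM.
  apply/measurableT_comp => //; apply: measurable_funM => //.
  exact: measurable_funX.
have f0 x : (0 <= f x)%E by rewrite lee_fin mulr_ge0 ?expR_ge0.
pose U : {RV P >-> R} := HB.pack (Y i) (isMeasurableFun.Build _ _ _ _ _ (mY i)).
transitivity (\int[P]_w f (U w, V w))%E.
  apply: eq_integral => w _; rewrite big_cons /f /= -expRD -mulrDr.
  by congr (expR (th * _))%:E; rewrite addrC.
rewrite (adapted_fubini indA dis (aY i : adapted X _ U) aV mf f0).
transitivity (\int[P]_w (((Num.sqrt D)^-1)%:E * (expR (th * V w))%:E))%E.
  apply: eq_integral => w _; rewrite ge0_integral_distribution//; last first.
    apply: (measurableT_comp mf); apply/measurable_fun_pairP.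
    by split; [exact: measurable_id|exact: measurable_cst].
  rewrite /f /= /comp /=; under eq_integral do rewrite EFinM.
  rewrite ge0_integralZl//; first by rewrite intY muleC.
  apply/measurable_EFinP/measurableT_comp => //; apply: measurable_funM => //.
  exact: measurable_funX.
rewrite ge0_integralZl//; last first.
  by apply/measurable_EFinP/measurableT_comp => //; exact: measurable_funM.
by rewrite IH// -EFinM exprS.
Qed.

(** The indicator of [f >= 0] is at most [exp f]. *)
Lemma ge0_markov_expR (f : T -> R) : measurable_fun setT f ->
  (P [set w | (0 <= f w)%R] <= \int[P]_w (expR (f w))%:E)%E.
Proof.
move=> mf.
have mS : measurable [set w | 0 <= f w].
  have := mf measurableT `[0, +oo[%classic (measurable_itv _).
  by rewrite setTI; congr measurable; apply/seteqP; split=> w /=; rewrite in_itv/= andbT.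
rewrite -[X in P X]setIT -integral_indic//.
apply: ge0_le_integral => //.
- by apply/measurable_EFinP; exact: measurable_indic.
- by apply/measurable_EFinP/measurableT_comp.
- move=> w _; rewrite lee_fin indicE.
  case: (boolP (_ \in _)) => /= [|_]; last exact: expR_ge0.
  by rewrite inE/= => fw; rewrite -[leLHS]expR0 ler_expR.
Qed.

Lemma measurable_norm2_sample (n N : nat) (A : 'I_n -> 'I_N -> {RV P >-> R})
  (z : 'cV[R]_N) : measurable_fun setT (fun w => norm2 (sample_mx A w *m z) ^+ 2).
Proof.
rewrite (_ : (fun _ => _) = fun w => \sum_i (\sum_j A i j w * z j ord0) ^+ 2).
  apply: measurable_sum => i; apply: measurable_funX.
  by apply: measurable_sum => j; apply: measurable_funM.
apply/funext => w; rewrite norm2_sqr; apply: eq_bigr => i _.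
by rewrite mxE; congr (_ ^+ 2); apply: eq_bigr => j _; rewrite mxE.
Qed.

(** Chernoff bound at the optimal parameter.  Writing the event as
    [(v - 1) * (...) >= 0] treats the upper tail ([v > 1]) and the lower tail
    ([v < 1]) at once: the optimal parameter has the sign of [v - 1]. *)
Lemma gaussian_norm_tail (n N : nat) (A : 'I_n -> 'I_N -> {RV P >-> R})
    (z : 'cV[R]_N) (v : R) : (0 < n)%N -> iid_gaussian A -> z != 0 -> 0 < v ->
  (P [set w | (0 <= (v - 1) * (norm2 (sample_mx A w *m z) ^+ 2 - v * norm2 z ^+ 2))%R]
   <= (expR (- (n%:R / 2 * (v - 1 - ln v))))%:E)%E.
Proof.
move=> n0 [indA nA] z0 v0.
have nz0 : 0 < norm2 z ^+ 2 := norm2_sqr_gt0 z0.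
have nzn : norm2 z != 0 by apply: contraTneq nz0 => ->; rewrite expr0n ltxx.
have nR : 0 < n%:R :> R by rewrite ltr0n.
have [vn nn] : v != 0 /\ n%:R != 0 :> R by rewrite !gt_eqF.
(* the optimal Chernoff parameter is [th = n / (2 |z|^2) * (1 - 1/v)] *)
pose K := n%:R / (2 * v * norm2 z ^+ 2).
have K0 : 0 < K by rewrite divr_gt0// mulr_gt0// mulr_gt0.
pose th := K * (v - 1).
pose g w := th * norm2 (sample_mx A w *m z) ^+ 2 - n%:R / 2 * (v - 1).
have mg : measurable_fun setT g.
  apply: measurable_funB => //; apply: measurable_funM => //.
  exact: measurable_norm2_sample.
have gE w : g w =
    K * ((v - 1) * (norm2 (sample_mx A w *m z) ^+ 2 - v * norm2 z ^+ 2)).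
  by rewrite /g /th /K; move: (norm2 (_ *m _)) => y; field; rewrite ?nzn ?vn.
under eq_set => w do rewrite -(pmulr_rge0 _ K0) -gE.
apply: le_trans (ge0_markov_expR mg) _.
pose s : R := Num.sqrt n%:R^-1.
have s2 : s ^+ 2 = n%:R^-1 by rewrite sqr_sqrtr// invr_ge0.
have thE : 1 - 2 * th * ((\sum_j z j ord0 ^+ 2) * s ^+ 2) = v^-1.
  by rewrite -norm2_sqr s2 /th /K; field; rewrite ?nzn ?vn ?nn.
under eq_integral do rewrite /g expRD EFinM muleC.
rewrite ge0_integralZl//; last first.
  apply/measurable_EFinP/measurableT_comp => //; apply: measurable_funM => //.
  exact: measurable_norm2_sample.
have -> : (\int[P]_w (expR (th * norm2 (sample_mx A w *m z) ^+ 2))%:E =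
    (Num.sqrt v ^+ n)%:E)%E.
  have := @integral_expR_rows n N A s (fun j => z j ord0) th (index_enum 'I_n) indA nA.
  rewrite thE sqrtr_gt0 !invr_gt0 nR v0 index_enum_uniq => /(_ isT isT isT).
  rewrite sqrtrV ?ltW// invrK.
  have -> : size (index_enum 'I_n) = n by rewrite -[RHS]card_ord cardT enumT.
  move=> <-; apply: eq_integral => w _; congr (expR (th * _))%:E.
  rewrite norm2_sqr; apply: eq_bigr => i _; rewrite mxE; congr (_ ^+ 2).
  by apply: eq_bigr => j _; rewrite mxE.
rewrite -EFinM lee_fin.
have -> : Num.sqrt v ^+ n = expR (n%:R / 2 * ln v).
  rewrite -[Num.sqrt v]lnK ?posrE ?sqrtr_gt0// -expRM_natl; congr expR.
  have : ln v = 2 * ln (Num.sqrt v).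
    rewrite -[in LHS](sqr_sqrtr (ltW v0)) lnXn ?sqrtr_gt0// mulr_natl//.
  by move=> ->; field.
by rewrite -expRD ler_expR; lra.
Qed.

End GaussianForms.

(** * Integer nets of the sparse sphere *)

Section Net.
Context {R : realType}.

(** Nonzero integers of absolute value at most [L] are coded by a sign and a
    predecessor, and zero by [None], so that every integer has a unique code;
    with two codes for zero the count in [card_net] would be off by a factor
    [2^N]. *)
Definition net_entry {L : nat} (o : option (bool * 'I_L)) : R :=
  if o is Some (b, m) then (-1) ^+ b * m.+1%:R else 0.

Definition net_height {L : nat} (o : option (bool * 'I_L)) : nat :=
  if o is Some (_, m) then m.+1 else 0.

Definition net_vector {N L : nat} (f : {ffun 'I_N -> option (bool * 'I_L)}) :
  'cV[R]_N := \col_i net_entry (f i).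

Definition net (N k L : nat) : {set {ffun 'I_N -> option (bool * 'I_L)}} :=
  [set f : {ffun 'I_N -> option (bool * 'I_L)} |
    (#|[pred i | f i != None]| <= k)%N && (\sum_i net_height (f i) <= L)%N]%SET.

Lemma sum_half_pow L : \sum_(m < L) 2^-1 ^+ m.+1 = 1 - 2^-1 ^+ L :> R.
Proof.
elim: L => [|L IH]; first by rewrite big_ord0 subrr.
by rewrite big_ord_recr/= IH exprS; field.
Qed.

Lemma sum_nat_of_bool (I : finType) (p : pred I) :
  (\sum_i p i = #|[pred i | p i]|)%N.
Proof.
rewrite -sum1_card [RHS]big_mkcond; apply: eq_bigr => i _.
by rewrite inE; case: (p i).
Qed.

(** A generating function: give the vector [z] the weight
    [s^(number of nonzero entries) * 2^(-l1-norm)].  The weight is at least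
    [s^k * 2^(-L)] on the net, and the total weight of all vectors is at most
    [(1 + 2 s)^N].  At [s = k/N] this has the order of the number of supports of
    size [k], up to a factor exponential in [k] and [L]. *)
Lemma card_net N k L (s : R) : 0 < s <= 1 ->
  #|net N k L|%:R <= s^-1 ^+ k * 2 ^+ L * expR (2 * s * N%:R).
Proof.
move=> /andP[s0 s1].
pose w (o : option (bool * 'I_L)) : R := s ^+ (o != None) * 2^-1 ^+ net_height o.
have w0 o : 0 <= w o by rewrite mulr_ge0// exprn_ge0// ?invr_ge0// ltW.
have sum_w : \sum_o w o <= expR (2 * s).
  have -> : \sum_o w o = 1 + \sum_(b : bool) \sum_(m < L) s * 2^-1 ^+ m.+1.
    rewrite (bigD1 None)//= (reindex_omap Some id)/=; last by case.
    rewrite pair_bigA/= /w !expr0 mulr1; congr (1 + _).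
    by apply: eq_big => [p|[b m] _] /=; rewrite ?eqxx ?expr1.
  apply: le_trans (expR_ge1Dx _); rewrite lerD2l.
  rewrite big_bool/= -mulr_sumr sum_half_pow.
  suff : s * (1 - 2^-1 ^+ L) <= s by lra.
  by rewrite ler_piMr ?(ltW s0)// gerBl exprn_ge0// invr_ge0.
have one f : f \in net N k L -> 1 <= s^-1 ^+ k * 2 ^+ L * \prod_i w (f i).
  rewrite inE => /andP[fk fL].
  rewrite big_split/= !prodrXr mulrACA; apply: mulr_ege1.
    rewrite sum_nat_of_bool.
    rewrite -[in leRHS](subnK fk) exprD -mulrA -exprMn mulVf ?gt_eqF//.
    by rewrite expr1n mulr1 exprn_ege1// invf_ge1.
  move: (\sum_i _)%N fL => h fL.
  rewrite -[in leRHS](subnK fL) exprD -mulrA -exprMn mulfV//.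
  by rewrite expr1n mulr1 exprn_ege1// ler1n.
rewrite -sum1_card natr_sum.
apply: (@le_trans _ _ (\sum_(f in net N k L) (s^-1 ^+ k * 2 ^+ L * \prod_i w (f i)))).
  by apply: ler_sum => f fn; exact: one.
rewrite -mulr_sumr ler_pM2l; last by rewrite mulr_gt0 ?exprn_gt0 ?invr_gt0.
apply: (@le_trans _ _ (\sum_(f : {ffun 'I_N -> option (bool * 'I_L)}) \prod_i w (f i))).
  rewrite [leRHS](bigID (mem (net N k L)))/= lerDl sumr_ge0// => f _.
  by apply: prodr_ge0 => i _.
rewrite -(bigA_distr_bigA (fun (i : 'I_N) o => w o))/=.
rewrite prodr_const card_ord expRM_natr.
by apply: lerXn2r; rewrite ?nnegrE ?expR_ge0// sumr_ge0.
Qed.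


(** Cauchy-Schwarz on the support, in the form
    [|t| <= (r t^2 + 1/r) / 2] with [r = sqrt k]. *)
Lemma sum_abs_sparse N k (x : 'cV[R]_N) : (0 < k)%N -> chi k x ->
  \sum_i x i ord0 ^+ 2 = 1 -> \sum_i `|x i ord0| <= Num.sqrt k%:R.
Proof.
move=> k0 xk x1; set r := Num.sqrt _.
have kR : 0 < k%:R :> R by rewrite ltr0n.
have r0 : 0 < r by rewrite sqrtr_gt0.
have r2 : r ^+ 2 = k%:R by rewrite sqr_sqrtr// ltW.
have le1 i : `|x i ord0| <= 2^-1 * (r * x i ord0 ^+ 2 + r^-1 * (x i ord0 != 0)%:R).
  have [->|xi0] /= := eqVneq (x i ord0) 0.
    by rewrite normr0 expr0n/= !mulr0 addr0 mulr0.
  rewrite -(real_normK (num_real (x i ord0))) mulr1.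
  rewrite -subr_ge0 (_ : _ - _ = 2^-1 * r^-1 * (r * `|x i ord0| - 1) ^+ 2).
    by rewrite mulr_ge0 ?sqr_ge0// mulr_ge0 ?invr_ge0// ltW.
  by field; rewrite gt_eqF.
apply: le_trans (ler_sum _ (fun i _ => le1 i)) _.
rewrite -mulr_sumr big_split/= -!mulr_sumr x1 mulr1 -natr_sum.
rewrite sum_nat_of_bool.
suff : r^-1 * #|[pred i | x i ord0 != 0%R]|%:R <= r by lra.
rewrite mulrC ler_pdivrMr// -expr2 r2 ler_nat; exact: xk.
Qed.

(** Multiply [x] by [M = q sqrt k] and truncate each entry towards zero.  Zero
    entries stay zero, so sparsity is preserved; each of the at most [k] others
    moves by at most [1/M], which gives the squared error [k / M^2 = 1 / q^2];
    and truncation towards zero does not increase norms, so the [l1]-norm of the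
    integer vector is at most [M sqrt k = k q]. *)
Lemma net_approx N k q (x : 'cV[R]_N) : (0 < k)%N -> (0 < q)%N -> chi k x ->
    \sum_i x i ord0 ^+ 2 = 1 ->
  exists2 f : {ffun 'I_N -> option (bool * 'I_(k * q))}, f \in net N k (k * q) &
  exists2 c : R, 0 < c &
  let y := c *: net_vector f in
  [/\ chi k (x - y), norm2 (x - y) ^+ 2 <= q%:R^-1 ^+ 2 & norm2 y ^+ 2 <= 1].
Proof.
move=> k0 q0 xk x1.
have kR : 0 < k%:R :> R by rewrite ltr0n.
have qR : 0 < q%:R :> R by rewrite ltr0n.
pose M : R := q%:R * Num.sqrt k%:R.
have M0 : 0 < M by rewrite mulr_gt0// sqrtr_gt0.
have M2 : M ^+ 2 = q%:R ^+ 2 * k%:R by rewrite exprMn sqr_sqrtr// ltW.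
pose t i := Num.truncn (`|x i ord0| * M).
have xM0 i : 0 <= `|x i ord0| * M by rewrite mulr_ge0// ltW.
have tle i : (t i)%:R <= `|x i ord0| * M by rewrite truncn_le.
have tgt i : `|x i ord0| * M < (t i).+1%:R by rewrite truncnS_gt.
have sumt : (\sum_i t i <= k * q)%N.
  rewrite -(ler_nat R) natr_sum.
  apply: le_trans (ler_sum _ (fun i _ => tle i)) _; rewrite -mulr_suml.
  apply: le_trans (ler_wpM2r (ltW M0) (sum_abs_sparse k0 xk x1)) _.
  by rewrite /M mulrCA -expr2 sqr_sqrtr ?(ltW kR)// natrM [leRHS]mulrC.
have t_le i : (t i <= k * q)%N.
  by apply: leq_trans sumt; rewrite (bigD1 i)//= leq_addr.
have t0 i : x i ord0 = 0 -> t i = 0%N.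
  by move=> xi; apply/eqP; rewrite -leqn0 -(ler_nat R) (le_trans (tle i))// xi normr0 mul0r.
pose g i : option (bool * 'I_(k * q)) :=
  if t i is m.+1 then omap (fun o => (x i ord0 < 0, o)) (insub m) else None.
pose f := [ffun i => g i].
have gP i : net_height (g i) = t i /\ net_entry (g i) = (-1) ^+ (x i ord0 < 0)%R * (t i)%:R.
  have := t_le i; rewrite /g; case: (t i) => [|m] mkq; first by rewrite mulr0.
  by rewrite (insubT (fun m => m < k * q)%N mkq) /net_height /net_entry /= ?SubK.
have fN i : f i != None -> x i ord0 != 0.
  by apply: contra_neq => xi; rewrite ffunE /g t0.
exists f.
  rewrite inE; apply/andP; split; last first.
    apply: leq_trans sumt; apply: leq_sum => i _.
    by rewrite ffunE (gP i).1.
  apply: leq_trans xk; apply: subset_leq_card; apply/fintype.subsetP => i.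
  by rewrite !inE; exact: fN.
exists M^-1; first by rewrite invr_gt0.
have yE i : (M^-1 *: net_vector f) i ord0 = (-1) ^+ (x i ord0 < 0)%R * ((t i)%:R / M).
  by rewrite !mxE ffunE (gP i).2 mulrC mulrA.
move=> y.
have xyE i : ((x - y) i ord0) ^+ 2 = (`|x i ord0| - (t i)%:R / M) ^+ 2.
  rewrite mxE [X in _ + X]mxE /y yE.
  rewrite {1}[x i ord0]realEsign ?num_real//.
  by rewrite -mulrBr exprMn sqrr_sign mul1r.
split.
- rewrite /chi/=; apply: leq_trans xk; apply: subset_leq_card.
  apply/fintype.subsetP => i; rewrite !inE; apply: contra_neq => xi.
  by rewrite mxE [X in _ + X]mxE /y yE xi t0// mul0r mulr0 subr0.
- rewrite norm2_sqr.
  apply: (@le_trans _ _ (\sum_i (x i ord0 != 0)%:R * M^-1 ^+ 2)).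
    apply: ler_sum => i _; rewrite xyE.
    have [xi|xi] /= := eqVneq (x i ord0) 0.
      by rewrite xi t0// normr0 mul0r subrr expr0n mul0r.
    rewrite mul1r; apply: lerXn2r.
    + by rewrite nnegrE subr_ge0 ler_pdivrMr.
    + by rewrite nnegrE invr_ge0 ltW.
    + rewrite lerBlDr -(ler_pM2r M0) mulrDl divfK ?mulVf ?gt_eqF// nat1r.
      exact: ltW.
  rewrite -mulr_suml -natr_sum.
  rewrite sum_nat_of_bool.
  rewrite exprVn M2 invfM mulrCA exprVn ler_piMr ?invr_ge0 ?exprn_ge0 ?(ltW qR)//.
  by rewrite ler_pdivrMr// mul1r ler_nat; exact: xk.
- rewrite norm2_sqr -x1; apply: ler_sum => i _.
  rewrite /y yE exprMn sqrr_sign mul1r -(real_normK (num_real (x i ord0))).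
  by apply: lerXn2r; rewrite ?nnegrE ?divr_ge0 ?(ltW M0)// ler_pdivrMr.
Qed.

(** Used in place of the triangle inequality: it speaks of squared norms, as the
    Rayleigh quotients do. *)
Lemma norm2_young N (e : R) (a b : 'cV[R]_N) : 0 < e ->
  norm2 (a + b) ^+ 2 <= (1 + e) * norm2 a ^+ 2 + (1 + e^-1) * norm2 b ^+ 2.
Proof.
move=> e0; rewrite !norm2_sqr !mulr_sumr -big_split/=; apply: ler_sum => i _.
rewrite mxE -subr_ge0.
rewrite (_ : _ - _ = e^-1 * (e * a i ord0 - b i ord0) ^+ 2); last by field; rewrite gt_eqF.
by rewrite mulr_ge0 ?sqr_ge0// invr_ge0 ltW.
Qed.

Lemma norm2N N (x : 'cV[R]_N) : norm2 (- x) = norm2 x.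
Proof. by rewrite /norm2; congr Num.sqrt; apply: eq_bigr => i _; rewrite mxE sqrrN. Qed.

Lemma norm2_mul_le_sup k n N (A : 'M[R]_(n, N)) (u : 'cV[R]_N) :
  (0 < k)%N -> (0 < N)%N -> chi k u ->
  norm2 (A *m u) ^+ 2 <= sup (rayleigh_quotients k A) * norm2 u ^+ 2.
Proof.
move=> k0 N0 uk; have [->|u0] := eqVneq u 0.
  by rewrite mulmx0 !norm2_sqr !big1 ?mulr0// => i _; rewrite mxE expr0n.
rewrite -ler_pdivrMr ?norm2_sqr_gt0//.
by have [_] := rayleigh_quotients_max A k0 N0; apply; exists u.
Qed.

Lemma rayleigh_unit_vector k n N (A : 'M[R]_(n, N)) (r : R) :
  rayleigh_quotients k A r -> exists x : 'cV[R]_N,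
    [/\ chi k x, \sum_i x i ord0 ^+ 2 = 1 & norm2 (A *m x) ^+ 2 = r].
Proof.
rewrite rayleigh_quotientsE => -[v [v1 vk] <-]; exists v^T; split => //.
by rewrite -v1; apply: eq_bigr => i _; rewrite mxE.
Qed.

(** The approximation error is itself [k]-sparse, so it is controlled by the
    very supremum that is being estimated. *)
Lemma norm2_young_net_error N k n q (A : 'M[R]_(n, N)) (u : 'cV[R]_N) (S : R) :
    (0 < k)%N -> (0 < N)%N -> (0 < q)%N ->
    sup (rayleigh_quotients k A) <= S -> chi k u ->
    norm2 u ^+ 2 <= q%:R^-1 ^+ 2 ->
  (1 + q%:R) * norm2 (A *m u) ^+ 2 <= S * (q%:R^-1 + q%:R^-1 ^+ 2).
Proof.
move=> k0 N0 q0 SS uk uq.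
have qR : 0 < q%:R :> R by rewrite ltr0n.
have SQ0 : 0 <= sup (rayleigh_quotients k A).
  have [[x _ <-] _] := rayleigh_quotients_max A k0 N0.
  by rewrite mulr_ge0 ?invr_ge0 ?sqr_ge0.
have Au : norm2 (A *m u) ^+ 2 <= S * q%:R^-1 ^+ 2.
  apply: le_trans (norm2_mul_le_sup A k0 N0 uk) _.
  by apply: ler_pM => //; exact: sqr_ge0.
apply: le_trans (ler_wpM2l _ Au) _; first by rewrite addr_ge0// ltW.
by rewrite le_eqVlt; apply/orP; left; apply/eqP; field; rewrite gt_eqF.
Qed.

(** With [e = 1/q] and [S] the supremum, attained at [x], splitting [x] into a
    net point and an error gives [S <= (1 + e) v + S (e + e^2)], which is solved
    for [S]. *)
Lemma sup_rayleigh_net k n N q (A : 'M[R]_(n, N)) (v : R) :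
    (0 < k)%N -> (0 < N)%N -> (4 <= q)%N -> 0 <= v ->
    (forall f, f \in net N k (k * q) ->
      norm2 (A *m net_vector f) ^+ 2 <= v * norm2 (net_vector f) ^+ 2) ->
  sup (rayleigh_quotients k A) <= v * (1 + 4 / q%:R).
Proof.
move=> k0 N0 q4 v0 Av; have q0 : (0 < q)%N by apply: leq_trans q4.
have [/rayleigh_unit_vector[x [xk x1 Sx]] _] := rayleigh_quotients_max A k0 N0.
have [f fN [c c0 /=]] := net_approx k0 q0 xk x1.
set y := c *: _ => -[uk uq y1].
have qR : 4 <= q%:R :> R by rewrite ler_nat.
set S := sup _ in Sx *.
have := norm2_young_net_error k0 N0 q0 (lexx S) uk uq.
have Ay : norm2 (A *m y) ^+ 2 <= v.
  rewrite /y -scalemxAr norm2Z_sqr.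
  apply: le_trans (_ : v * (norm2 y ^+ 2) <= _); last by rewrite ler_piMr.
  by rewrite /y norm2Z_sqr [leRHS]mulrCA; apply: ler_wpM2l; [exact: sqr_ge0|exact: Av].
have eR : 0 < q%:R^-1 :> R by rewrite invr_gt0; lra.
have e4 : q%:R^-1 <= 4^-1 :> R by rewrite lef_pV2 ?posrE//; lra.
have := norm2_young (A *m y) (A *m (x - y)) eR.
rewrite -mulmxDr addrC subrK Sx invrK.
move: (q%:R^-1) eR e4 => e e0 e4.
move: (norm2 (A *m y) ^+ 2) (_ * norm2 (A *m (x - y)) ^+ 2) Ay => Y U Yv h1 h2.
have h3 : S * (1 - e - e ^+ 2) <= (1 + e) * v.
  have := ler_wpM2l (_ : 0 <= 1 + e) Yv; lra.
have D0 : 0 < 1 - e - e ^+ 2 by nra.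
rewrite -(ler_pM2r D0); apply: le_trans h3 _.
rewrite mulrC -mulrA; apply: ler_wpM2l => //; nra.
Qed.

(** At a minimizer [x], the net point [y] satisfies
    [w |y|^2 <= |A y|^2 <= (1 + e) |A x|^2 + (1 + e) e S], and [y] is
    almost as long as [x].  The supremum enters through the error term, so an
    upper bound [S] on it is needed here. *)
Lemma inf_rayleigh_net k n N q (A : 'M[R]_(n, N)) (w S : R) :
    (0 < k)%N -> (0 < N)%N -> (4 <= q)%N -> 0 <= w -> 0 <= S ->
    sup (rayleigh_quotients k A) <= S ->
    (forall f, f \in net N k (k * q) ->
      w * norm2 (net_vector f) ^+ 2 <= norm2 (A *m net_vector f) ^+ 2) ->
  w - (3 * w + S) / q%:R <= inf (rayleigh_quotients k A).
Proof.
move=> k0 N0 q4 w0 S0 supS Aw; have q0 : (0 < q)%N by apply: leq_trans q4.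
have [/rayleigh_unit_vector[x [xk x1 Ix]] _] := rayleigh_quotients_min A k0 N0.
have [f fN [c c0 /=]] := net_approx k0 q0 xk x1.
set y := c *: _ => -[uk uq y1].
have qR : 4 <= q%:R :> R by rewrite ler_nat.
set J := inf _ in Ix *.
have := norm2_young_net_error k0 N0 q0 supS uk uq.
have Ay : w * norm2 y ^+ 2 <= norm2 (A *m y) ^+ 2.
  rewrite /y -scalemxAr !norm2Z_sqr [leLHS]mulrCA; apply: ler_wpM2l; [exact: sqr_ge0|exact: Aw].
have eR : 0 < q%:R^-1 :> R by rewrite invr_gt0; lra.
have e4 : q%:R^-1 <= 4^-1 :> R by rewrite lef_pV2 ?posrE//; lra.
have := norm2_young (A *m x) (- (A *m (x - y))) eR.
rewrite norm2N -mulmxN -mulmxDr opprB addrC subrK Ix invrK.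
have := norm2_young y (x - y) eR.
rewrite addrC subrK [norm2 x ^+ 2]norm2_sqr x1 invrK => h1 h2 h3.
have h4 : (1 + q%:R) * norm2 (x - y) ^+ 2 <= q%:R^-1 + q%:R^-1 ^+ 2.
  apply: le_trans (ler_wpM2l _ uq) _; first by lra.
  by rewrite le_eqVlt; apply/orP; left; apply/eqP; field; lra.
move: h1 h2 h3 h4 Ay.
have Y0 : 0 <= norm2 y ^+ 2 by exact: sqr_ge0.
have J0 : 0 <= J by rewrite -Ix sqr_ge0.
move: (q%:R^-1) eR e4 => e e0 e4.
move: (norm2 (A *m y) ^+ 2) (_ * norm2 (A *m (x - y)) ^+ 2) (_ * norm2 (x - y) ^+ 2).
move: (norm2 y ^+ 2) Y0 => Y Y0 Z U V h1 h2 h3 h4 h5.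
have hY : 1 - 2 * e <= Y.
  have e1 : 0 < 1 + e by lra.
  rewrite -(ler_pM2l e1); nra.
have hwY : w * (1 - 2 * e) <= w * Y by exact: ler_wpM2l.
have : w * (1 - 2 * e) <= (1 + e) * (J + S * e) by lra.
have e1 : 0 < 1 + e by lra.
have : w * (1 - 3 * e) - S * e <= J.
  have we : 0 <= w * e ^+ 2 by rewrite mulr_ge0 ?sqr_ge0.
  by rewrite -(ler_pM2l e1); nra.
lra.
Qed.

End Net.

(** * Measurability of the extremal Rayleigh quotients *)

Lemma exists_net_resolution {R : realType} (K e : R) : 0 < e ->
  exists2 q : nat, (4 <= q)%N & K / q%:R < e.
Proof.
move=> e0; pose q := (Num.truncn (`|K| / e)).+4.
exists q => //; have qR : 0 < q%:R :> R by rewrite ltr0n.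
rewrite ltr_pdivrMr// mulrC -ltr_pdivrMr//.
apply: (@le_lt_trans _ _ (`|K| / e)).
  by rewrite ler_pM2r ?invr_gt0// ler_norm.
apply: lt_le_trans (truncnS_gt _) _.
by rewrite ler_nat ltnS -addn3 leq_addr.
Qed.

Section Measurability.
Context {R : realType} {d : measure_display} {T : measurableType d}.
Variables (P : probability T R) (k n N : nat) (A : 'I_n -> 'I_N -> {RV P >-> R}).
Hypotheses (k0 : (0 < k)%N) (N0 : (0 < N)%N).

Lemma le_of_forall_inv_nat (a b K : R) :
  (forall q, (4 <= q)%N -> a <= b + K / q%:R) -> a <= b.
Proof.
move=> h; apply/ler_addgt0Pr => e e0.
have [q q4 Kq] := exists_net_resolution K e0.
by apply: le_trans (h q q4) _; rewrite lerD2l ltW.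
Qed.

Lemma sup_rayleigh_ge0 (B : 'M[R]_(n, N)) : 0 <= sup (rayleigh_quotients k B).
Proof.
have [[x _ <-] _] := rayleigh_quotients_max B k0 N0.
by rewrite mulr_ge0 ?invr_ge0 ?sqr_ge0.
Qed.

Lemma inf_rayleigh_ge0 (B : 'M[R]_(n, N)) : 0 <= inf (rayleigh_quotients k B).
Proof.
have [[x _ <-] _] := rayleigh_quotients_min B k0 N0.
by rewrite mulr_ge0 ?invr_ge0 ?sqr_ge0.
Qed.

Lemma chi_net_vector q (f : {ffun 'I_N -> option (bool * 'I_(k * q))}) :
  f \in net N k (k * q) -> chi k (net_vector f : 'cV[R]_N).
Proof.
rewrite inE => /andP[fk _]; apply: leq_trans fk; apply: subset_leq_card.
by apply/fintype.subsetP => i; rewrite !inE !mxE; case: (f i) => //=; rewrite eqxx.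
Qed.

Lemma norm2_mul_ge_inf (B : 'M[R]_(n, N)) (u : 'cV[R]_N) : chi k u ->
  inf (rayleigh_quotients k B) * norm2 u ^+ 2 <= norm2 (B *m u) ^+ 2.
Proof.
move=> uk; have [->|u0] := eqVneq u 0.
  by rewrite mulmx0 !norm2_sqr !big1 ?mulr0// => i _; rewrite mxE expr0n.
rewrite -ler_pdivlMr ?norm2_sqr_gt0//.
by have [_] := rayleigh_quotients_min B k0 N0; apply; exists u.
Qed.

(** The nets of all resolutions determine the supremum, because the relative
    error [4/q] in [sup_rayleigh_net] vanishes as [q] grows.  This writes an
    event about an uncountable supremum as a countable intersection. *)
Lemma sup_rayleigh_leP (B : 'M[R]_(n, N)) (c : R) : 0 <= c ->
  sup (rayleigh_quotients k B) <= c <->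
  forall q f, f \in net N k (k * q) ->
    norm2 (B *m net_vector f) ^+ 2 <= c * norm2 (net_vector f) ^+ 2.
Proof.
move=> c0; split=> [supc q f /chi_net_vector fk|h].
  apply: le_trans (norm2_mul_le_sup B k0 N0 fk) _.
  by apply: ler_wpM2r => //; exact: sqr_ge0.
apply: (@le_of_forall_inv_nat _ _ (c * 4)) => q q4.
rewrite -mulrA -[X in X + _]mulr1 -mulrDr.
by apply: sup_rayleigh_net => // f; exact: h.
Qed.

Lemma inf_rayleigh_geP (B : 'M[R]_(n, N)) (c : R) : 0 <= c ->
  c <= inf (rayleigh_quotients k B) <->
  forall q f, f \in net N k (k * q) ->
    c * norm2 (net_vector f) ^+ 2 <= norm2 (B *m net_vector f) ^+ 2.
Proof.
move=> c0; split=> [infc q f /chi_net_vector fk|h].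
  apply: le_trans (norm2_mul_ge_inf B fk).
  by apply: ler_wpM2r => //; exact: sqr_ge0.
apply: (@le_of_forall_inv_nat _ _ (3 * c + sup (rayleigh_quotients k B))) => q q4.
rewrite -lerBlDr; apply: inf_rayleigh_net => //.
  exact: sup_rayleigh_ge0.
by move=> f; exact: h.
Qed.

Lemma measurable_net_event (p : R -> R -> bool) :
    (forall b : R, measurable [set y | p y b]) ->
  measurable [set w | forall q f, f \in net N k (k * q) ->
    p (norm2 (sample_mx A w *m net_vector f) ^+ 2) (norm2 (net_vector f : 'cV[R]_N) ^+ 2)].
Proof.
move=> mp.
rewrite (_ : [set _ | _] = \bigcap_q \bigcap_(f in [set` net N k (k * q)])
    [set w | p (norm2 (sample_mx A w *m net_vector f) ^+ 2)
               (norm2 (net_vector f : 'cV[R]_N) ^+ 2)]).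
  apply: bigcapT_measurable => q; apply: fin_bigcap_measurable => [|f _].
    exact: finite_finset.
  have := measurable_norm2_sample A (net_vector f) measurableT
    (mp (norm2 (net_vector f : 'cV[R]_N) ^+ 2)).
  by rewrite setTI.
by apply/seteqP; split=> w h q => [_ f|f]; [exact: h|exact: (h q I f)].
Qed.

Lemma measurable_sup_rayleigh_le (c : R) :
  measurable [set w | sup (rayleigh_quotients k (sample_mx A w)) <= c].
Proof.
have [c0|c0] := ltP c 0.
  rewrite (_ : [set _ | _] = set0)//; apply/seteqP; split=> // w /= h.
  by have := le_lt_trans (le_trans (sup_rayleigh_ge0 _) h) c0; rewrite ltxx.
under eq_set => w do rewrite (propext (sup_rayleigh_leP _ c0)).
apply: (@measurable_net_event (fun y b => y <= c * b)) => b.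
rewrite (_ : [set y | y <= c * b] = `]-oo, (c * b)]%classic); first exact: measurable_itv.
by apply/seteqP; split=> y /=; rewrite in_itv.
Qed.

Lemma measurable_inf_rayleigh_ge (c : R) :
  measurable [set w | c <= inf (rayleigh_quotients k (sample_mx A w))].
Proof.
have [c0|c0] := ltP c 0.
  rewrite (_ : [set _ | _] = setT)//; apply/seteqP; split=> // w _ /=.
  by apply: le_trans (ltW c0) (inf_rayleigh_ge0 _).
under eq_set => w do rewrite (propext (inf_rayleigh_geP _ c0)).
apply: (@measurable_net_event (fun y b => c * b <= y)) => b.
rewrite (_ : [set y | c * b <= y] = `[(c * b), +oo[%classic); first exact: measurable_itv.
by apply/seteqP; split=> y /=; rewrite in_itv/= andbT.
Qed.

Lemma measurable_lt_of_le (f : T -> R) (c : R) :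
  (forall b, measurable [set w | f w <= b]) -> measurable [set w | f w < c].
Proof.
move=> mf; rewrite (_ : [set _ | _] = \bigcup_m [set w | f w <= c - m.+1%:R^-1]).
  by apply: bigcupT_measurable => m; exact: mf.
apply/seteqP; split=> [w /= /ltr_add_invr[m fm]|w [m _ /= fm]].
  by exists m => //=; rewrite lerBrDr ltW.
by apply: le_lt_trans fm _; rewrite gtrBl invr_gt0.
Qed.

Lemma measurable_ric_upper_lt (c : R) :
  measurable [set w | ric_upper k (sample_mx A w) < c].
Proof.
apply: measurable_lt_of_le => b; rewrite /ric_upper.
under eq_set do rewrite lerBlDr.
exact: measurable_sup_rayleigh_le.
Qed.

Lemma measurable_ric_lower_lt (c : R) :
  measurable [set w | ric_lower k (sample_mx A w) < c].
Proof.
apply: measurable_lt_of_le => b; rewrite /ric_lower.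
under eq_set do rewrite lerBlDr addrC -lerBlDr.
exact: measurable_inf_rayleigh_ge.
Qed.

End Measurability.

(** * The large deviation rate and the bounds for small delta *)

Section Analysis.
Context {R : realType}.
Implicit Types u a c : R.

Lemma is_derive_ln1p_remainder u : -1 < u ->
  is_derive u 1 (fun x : R => x - x ^+ 2 / 2 + x ^+ 3 / 3 - ln (1 + x))
    (u ^+ 3 / (1 + u)).
Proof.
move=> u1; have u0 : 0 < 1 + u by lra.
have dln := is_derive1_ln u0.
have d1 : is_derive u 1 (fun x : R => 1 + x) 1.
  by apply: is_derive_eq; rewrite add0r mul1r.
have dl : is_derive u 1 (@ln R \o (fun x : R => 1 + x)) ((1 + u)^-1).
  by have := @is_derive1_comp _ (@ln R) (fun x : R => 1 + x) u _ _ dln d1; rewrite mulr1.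
have d2 : is_derive u 1 (fun x : R => x - x ^+ 2 / 2 + x ^+ 3 / 3) (1 - u + u ^+ 2).
  by apply: is_derive_eq; rewrite /GRing.scale /=; field.
apply: (is_derive_eq (is_deriveB d2 dl)).
by field; rewrite gt_eqF.
Qed.

(** The difference of the two sides vanishes at [0] and has derivative
    [u^3 / (1 + u)], of the sign of [u]. *)
Lemma ln1p_le u : -1 < u -> ln (1 + u) <= u - u ^+ 2 / 2 + u ^+ 3 / 3.
Proof.
move=> u1; pose f x : R := x - x ^+ 2 / 2 + x ^+ 3 / 3 - ln (1 + x).
have df (x : R) : -1 < x -> is_derive x 1 f (x ^+ 3 / (1 + x)).
  exact: is_derive_ln1p_remainder.
have cf a b : -1 < a -> {within `[a, b], continuous f}.
  move=> a1; apply: derivable_within_continuous => x; rewrite in_itv/= => /andP[ax _].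
  by have [] := df x (lt_le_trans a1 ax).
have f0 : f 0 = 0 by rewrite /f addr0 ln1 !expr0n/= !mul0r !subr0 addr0.
suff : 0 <= f u by rewrite /f; lra.
have [u0|u0|->] := ltgtP u 0; last by rewrite f0.
  have [|x] := @MVT _ f (fun x => x ^+ 3 / (1 + x)) u 0 u0 _ (cf u 0 u1).
    by move=> x; rewrite in_itv/= => /andP[ux x0]; apply: df; lra.
  move=> /[!in_itv]/= /andP[ux x0]; rewrite f0 => fE.
  have : x ^+ 3 / (1 + x) <= 0.
    rewrite pmulr_lle0 ?invr_gt0; last lra.
    by rewrite exprS pmulr_lle0 ?exprn_even_gt0 ?(ltW x0)//= lt_eqF.
  by nra.
have N1 : -1 < 0 :> R by lra.
have [|x] := @MVT _ f (fun x => x ^+ 3 / (1 + x)) 0 u u0 _ (cf 0 u N1).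
  by move=> x; rewrite in_itv/= => /andP[x0 xu]; apply: df; lra.
move=> /[!in_itv]/= /andP[x0 xu]; rewrite f0 subr0 subr0 => ->.
by rewrite mulr_ge0 ?divr_ge0 ?exprn_ge0 ?(ltW x0)//; lra.
Qed.

(** The Cramer rate function of the chi-square law with one degree of freedom,
    up to a factor [2]. *)
Definition chi2_rate (v : R) : R := v - 1 - ln v.

Lemma chi2_rate_ge u : -1 < u -> u ^+ 2 / 2 - u ^+ 3 / 3 <= chi2_rate (1 + u).
Proof. by move=> /ln1p_le; rewrite /chi2_rate; lra. Qed.

(** For [u = a + c a^2] one has [u^2/2 - u^3/3 = a^2/2 + (c - 1/3) a^3 + O(a^4)]:
    the constant [1/3] of the theorem is the cubic coefficient of the logarithm. *)
Lemma chi2_rate_upper c : 1 / 3 < c <= 1 -> exists2 a0, 0 < a0 <= 1 &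
  forall a, 0 < a < a0 -> a ^+ 2 / 2 < chi2_rate (1 + (a + c * a ^+ 2)).
Proof.
move=> /andP[c3 c1]; exists ((3 * c - 1) / 8); first by lra.
move=> a /andP[a0 ac]; set u := a + _.
have u0 : 0 < u by rewrite /u; nra.
have a1 : a < 1 by lra.
apply: lt_le_trans (chi2_rate_ge _); last by lra.
have uE : u = a * (1 + c * a) by rewrite /u; ring.
have ca : 0 <= c * a <= a by apply/andP; split; nra.
have h1 : a ^+ 2 / 2 + c * a ^+ 3 <= u ^+ 2 / 2.
  have : 0 <= c ^+ 2 * a ^+ 4 by rewrite mulr_ge0 ?exprn_even_ge0.
  rewrite uE; nra.
have h2 : u ^+ 3 <= a ^+ 3 * (1 + 7 * a).
  rewrite uE exprMn ler_pM2l ?exprn_gt0//.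
  move: (c * a) ca => t /andP[t0 ta].
  have t1 : t <= 1 by lra.
  have : 0 <= t ^+ 2 * (1 - t) by rewrite mulr_ge0 ?sqr_ge0// subr_ge0.
  have : 0 <= t * (1 - t) by rewrite mulr_ge0// subr_ge0.
  nra.
have a3 : 0 < a ^+ 3 by rewrite exprn_gt0.
nra.
Qed.

(** For [u = - (a - c a^2)] one has
    [u^2/2 - u^3/3 = a^2/2 + (1/3 - c) a^3 + O(a^4)]. *)
Lemma chi2_rate_lower c : 0 <= c < 1 / 3 -> exists2 a0, 0 < a0 <= 1 &
  forall a, 0 < a < a0 -> a ^+ 2 / 2 < chi2_rate (1 - (a - c * a ^+ 2)).
Proof.
move=> /andP[c0 c3]; exists ((1 - 3 * c) / 2); first by lra.
move=> a /andP[a0 ac]; set u := a - _.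
have u0 : 0 < u by rewrite /u; nra.
have a1 : a < 1 by lra.
have u1 : u < 1 by rewrite /u; nra.
apply: lt_le_trans (chi2_rate_ge _); last by lra.
have uE : u = a * (1 - c * a) by rewrite /u; ring.
have h1 : a ^+ 2 / 2 - c * a ^+ 3 <= u ^+ 2 / 2.
  have : 0 <= c ^+ 2 * a ^+ 4 by rewrite mulr_ge0 ?exprn_even_ge0.
  rewrite uE; nra.
have h2 : a ^+ 3 * (1 - a) <= u ^+ 3.
  rewrite uE exprMn ler_pM2l ?exprn_gt0//.
  have ca : 0 <= c * a <= a / 3 by apply/andP; split; nra.
  move: (c * a) ca => t /andP[t0 ta].
  nra.
have a3 : 0 < a ^+ 3 by rewrite exprn_gt0.
nra.
Qed.

Lemma ln_le_sqrt (y : R) : 0 < y -> ln y <= 2 * Num.sqrt y.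
Proof.
move=> y0; rewrite -[in leLHS](sqr_sqrtr (ltW y0)) lnXn ?sqrtr_gt0//.
have : ln (Num.sqrt y) < Num.sqrt y by rewrite ln_sublinear// sqrtr_gt0.
by rewrite mulr2n; lra.
Qed.

Lemma small_ln_div (C e : R) : 0 < e -> exists2 M, 1 <= M &
  forall y : R, M < y -> (ln y + C) / y < e.
Proof.
move=> e0; pose K := (2 + `|C|) / e.
have K0 : 0 < K by rewrite divr_gt0// ltr_wpDr.
exists (1 + K ^+ 2) => [|y My]; first by rewrite lerDl sqr_ge0.
have y1 : 1 < y by apply: le_lt_trans My; rewrite lerDl sqr_ge0.
have y0 : 0 < y by lra.
have Ky : K < Num.sqrt y.
  by rewrite -[ltLHS](ger0_norm (ltW K0)) -sqrtr_sqr ltr_sqrt//; apply: lt_trans My; rewrite ltrDr.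
have s1 : 1 <= Num.sqrt y by rewrite -sqrtr1 ler_wsqrtr// ltW.
have s0 : 0 < Num.sqrt y by lra.
rewrite ltr_pdivrMr// -[in ltRHS](sqr_sqrtr (ltW y0)) expr2 mulrA.
apply: (@le_lt_trans _ _ ((2 + `|C|) * Num.sqrt y)).
  rewrite mulrDl; apply: lerD; first exact: ln_le_sqrt.
  by apply: le_trans (ler_norm C) _; rewrite ler_peMr.
rewrite ltr_pM2r//.
have -> : 2 + `|C| = e * K by rewrite /K mulrC divfK// gt_eqF.
by rewrite ltr_pM2l.
Qed.

Lemma ln_inv_large (gamma M : R) : 0 < gamma -> exists2 delta0, 0 < delta0 &
  forall delta, 0 < delta -> delta < delta0 -> M < gamma * ln (delta^-1).
Proof.
move=> g0; exists (expR (- (M / gamma))); first exact: expR_gt0.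
move=> delta d0 dd; rewrite -ltr_pdivrMl// mulrC lnV ?posrE// ltrNr.
by rewrite -[ltRHS]expRK ltr_ln ?posrE// expR_gt0.
Qed.

(** In the variable [y = gamma ln (1/delta)], which tends to infinity as
    [delta -> 0], one has [rho = 1/y] and [ln (1/delta) = y / gamma]. *)
Lemma rho_ln (gamma delta : R) : 0 < gamma -> 0 < delta -> 1 < gamma * ln (delta^-1) ->
  let y := gamma * ln (delta^-1) in
  [/\ rho gamma delta = y^-1, 0 < rho gamma delta &
   forall C, rho gamma delta * (ln (1 / (delta * rho gamma delta)) + C) =
     1 / gamma + (ln y + C) / y].
Proof.
move=> g0 d0 y1 y; have y0 : 0 < y by rewrite /y; lra.
have rE : rho gamma delta = y^-1 by rewrite /rho div1r.
split => //; first by rewrite rE invr_gt0.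
have gn : gamma != 0 by rewrite gt_eqF.
have : ln (delta^-1) = y / gamma by rewrite /y mulrC mulKf.
clearbody y => lnd C.
rewrite rE [1 / (_ * _)]div1r invfM invrK lnM ?posrE ?invr_gt0//; move: lnd.
have yn : y != 0 by rewrite gt_eqF.
by move: (ln y) => l ->; field; rewrite yn gn.
Qed.

Lemma bound_argE (gamma delta : R) : 0 < gamma -> 0 < delta ->
    1 < gamma * ln (delta^-1) ->
  let y := gamma * ln (delta^-1) in
  bound_arg gamma delta = 4 / gamma + 6 * ((ln y + 1) / y).
Proof.
move=> g0 d0 y1 y; have y0 : 0 < y by rewrite /y; lra.
rewrite /bound_arg; have [-> _ _] := rho_ln g0 d0 y1.
have gn : gamma != 0 by rewrite gt_eqF.
have : ln (delta^-1) = y / gamma by rewrite /y mulrC mulKf.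
rewrite -/y; clearbody y => lnd.
rewrite [1 / _]div1r invfM -!exprVn invrK lnM ?posrE ?exprn_gt0 ?invr_gt0//.
rewrite !lnXn ?invr_gt0//; move: lnd.
have yn : y != 0 by rewrite gt_eqF.
rewrite -(mulr_natl (ln (delta^-1)) 2) -(mulr_natl (ln y) 3).
by move: (ln y) => l ->; field; rewrite yn gn.
Qed.

Lemma Utilde_ge (cu c gamma delta : R) : 0 <= c <= cu -> 0 < gamma ->
  4 / gamma <= bound_arg gamma delta ->
  Num.sqrt (4 / gamma) + c * (4 / gamma) <= Utilde cu gamma delta.
Proof.
move=> /andP[c0 ccu] g0 xg; have x0 : 0 <= 4 / gamma by rewrite divr_ge0// ltW.
apply: lerD; first exact: ler_wsqrtr.
by apply: ler_pM.
Qed.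

(** The map [x |-> sqrt x - c x] is increasing as long as
    [2 c sqrt x <= 1]; with [c <= 1/3] the range [x <= 9/4] is safe. *)
Lemma Ltilde_ge (cl c gamma delta : R) : cl <= c -> 0 <= c <= 1 / 3 -> 0 < gamma ->
  4 / gamma <= bound_arg gamma delta <= 9 / 4 ->
  Num.sqrt (4 / gamma) - c * (4 / gamma) <= Ltilde cl gamma delta.
Proof.
move=> clc /andP[c0 c3] g0; rewrite /Ltilde.
move: (bound_arg _ _) => x /andP[xg x9].
have b0 : 0 <= 4 / gamma by rewrite divr_ge0// ltW.
move: (4 / gamma) b0 xg => b b0 bx; have x0 := le_trans b0 bx.
apply: (@le_trans _ _ (Num.sqrt x - c * x)); last first.
  by rewrite lerD2l lerN2 ler_wpM2r.
have sb := sqrtr_ge0 b; have sbx := ler_wsqrtr bx.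
have s9 : Num.sqrt x <= 3 / 2.
  by rewrite -[leRHS]ger0_norm// -sqrtr_sqr ler_wsqrtr//; lra.
rewrite -[in c * b](sqr_sqrtr b0) -[in c * x](sqr_sqrtr x0).
move: (Num.sqrt b) (Num.sqrt x) sb sbx s9 => p r p0 pr r9.
rewrite -subr_ge0 (_ : _ - _ = (r - p) * (1 - c * (r + p))); last by ring.
by rewrite mulr_ge0 ?subr_ge0//; nra.
Qed.

(** Four is a crude but sufficient threshold for the upper tail wherever the
    supremum only has to be bounded. *)
Lemma chi2_rate4 : 1 <= chi2_rate 4.
Proof.
have : ln (4 : R) <= 2; last by rewrite /chi2_rate; lra.
rewrite (_ : 4 = 2 ^+ 2); last by ring.
rewrite lnXn// mulr2n.
have := @le_ln1Dx R 1; have -> : 1 + 1 = 2 :> R by [].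
by move=> /(_ ltac:(lra)); lra.
Qed.

End Analysis.

(** * Union bound over the net and exponential convergence *)

Section UnionBound.
Context {R : realType} {d : measure_display} {T : measurableType d}.
Variables (P : probability T R).

Lemma probability_cover (I : eqType) (r : seq I) (B : I -> set T) (E : set T) :
    (forall i, measurable (B i)) -> measurable E ->
    (forall w, E w -> exists2 i, i \in r & B i w) ->
  (P E <= \sum_(i <- r) P (B i))%E.
Proof.
move=> mB; elim: r E => [|i r IH] E mE EB.
  rewrite big_nil (_ : E = set0) ?measure0//.
  by apply/seteqP; split=> // w /EB[].
rewrite big_cons.
have mEB : measurable (E `\` B i) by exact: measurableD.
apply: (@le_trans _ _ (P (B i `|` (E `\` B i)))).
  apply: le_measure; rewrite ?inE//; first exact: measurableU.
  by move=> w Ew; have [Bw|Bw] := pselect (B i w); [left|right].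
apply: le_trans (measureU2 _ _ _) _ => //; apply: leeD => //.
apply: IH => // w [/EB[j]]; rewrite inE => /predU1P[->|jr] Bj //.
by exists j.
Qed.

(** The list [vs] allows several thresholds at once, because the lower constant
    needs the lower tail for its own threshold and the upper tail for a crude
    one. *)
Lemma net_union_bound (k n N q : nat) (A : 'I_n -> 'I_N -> {RV P >-> R})
    (vs : seq R) (h : R) (E : set T) : (0 < n)%N -> iid_gaussian A ->
    measurable E -> (forall v, v \in vs -> 0 < v /\ h <= chi2_rate v) ->
    (forall w, ~ E w -> exists2 v, v \in vs & exists2 f, f \in net N k (k * q) &
      0 < (v - 1) * (norm2 (sample_mx A w *m net_vector f) ^+ 2 -
                     v * norm2 (net_vector f : 'cV[R]_N) ^+ 2)) ->
  (1 - P E <= ((size vs)%:R * #|net N k (k * q)|%:R * expR (- (n%:R / 2 * h)))%:E)%E.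
Proof.
move=> n0 iidA mE vsP EP.
pose fT : finType := {ffun 'I_N -> option (bool * 'I_(k * q))}.
pose g (vf : R * fT) w := (vf.1 - 1) * (norm2 (sample_mx A w *m net_vector vf.2) ^+ 2 -
                     vf.1 * norm2 (net_vector vf.2 : 'cV[R]_N) ^+ 2).
pose bad (vf : R * fT) := [set w | 0 < g vf w].
have mg vf : measurable_fun setT (g vf).
  apply: measurable_funM => //; apply: measurable_funB => //.
  exact: measurable_norm2_sample.
have mbad vf : measurable (bad vf).
  have := mg vf measurableT `]0, +oo[%classic (measurable_itv _).
  by rewrite setTI; congr measurable; apply/seteqP; split=> w /=; rewrite in_itv/= andbT.
have badP vf : vf.1 \in vs -> (P (bad vf) <= (expR (- (n%:R / 2 * h)))%:E)%E.
  case: vf => v f /= /vsP[v0 hv].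
  have [z0|z0] := eqVneq (net_vector f : 'cV[R]_N) 0.
    rewrite (_ : bad _ = set0) ?measure0 ?lee_fin ?expR_ge0//.
    apply/seteqP; split=> // w; rewrite /bad /g /= z0 mulmx0 !norm2_sqr.
    by rewrite !big1 ?mulr0 ?subr0 ?mulr0 ?ltxx// => i _; rewrite mxE expr0n.
  apply: le_trans (le_trans _ (gaussian_norm_tail n0 iidA z0 v0)) _.
    apply: le_measure; rewrite ?inE//; last by move=> w; exact: ltW.
    have := mg (v, f) measurableT `[0, +oo[%classic (measurable_itv _).
    by rewrite setTI; congr measurable; apply/seteqP; split=> w /=; rewrite in_itv/= andbT.
  rewrite lee_fin ler_expR lerN2 ler_wpM2l// divr_ge0//.
rewrite -probability_setC//.
pose r := [seq (v, f) | v <- vs, f <- enum (net N k (k * q))].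
apply: (@le_trans _ _ (\sum_(vf <- r) P (bad vf))%E).
  apply: probability_cover => //; first exact: measurableC.
  move=> w /EP[v vvs [f fn gvf]]; exists (v, f) => //.
  by apply/allpairsP; exists (v, f); rewrite mem_enum.
apply: (@le_trans _ _ (\sum_(vf <- r) (expR (- (n%:R / 2 * h)))%:E)%E).
  rewrite !big_seq; apply: lee_sum => vf /allpairsP[[v f] /= [vvs _ ->]].
  exact: badP.
rewrite sumEFin lee_fin big_const_seq count_predT size_allpairs -cardE.
by rewrite iter_addr_0 -[_ *+ (_ * _)]mulr_natl natrM.
Qed.

End UnionBound.

Section ExponentialConvergence.
Context {R : realType}.

(** The finitely many indices not covered by the hypothesis are absorbed in the
    constant, probabilities being at most [1]. *)
Lemma cvg1_exponentially_of_near (n : nat -> nat) (p : nat -> \bar R) (C c : R) :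
    n j @[j --> \oo] --> \oo -> 0 < C -> 0 < c ->
    (forall j, 0 <= p j <= 1)%E ->
    (\forall j \near \oo, (1 - p j <= (C * expR (- (c * (n j)%:R)))%:E)%E) ->
  @cvg1_exponentially R n p.
Proof.
move=> noo C0 c0 p01 [J _ hJ].
pose C' := C + \sum_(j < J) expR (c * (n j)%:R).
have C'0 : 0 < C' by rewrite ltr_wpDr// sumr_ge0// => j _; exact: expR_ge0.
have pfin j : p j \is a fin_num.
  by have /andP[p0 p1] := p01 j; rewrite ge0_fin_numE// (le_lt_trans p1)// ltry.
have bound j : (1 - p j <= (C' * expR (- (c * (n j)%:R)))%:E)%E.
  have [jJ|Jj] := ltnP j J; last first.
    apply: le_trans (hJ j Jj) _; rewrite lee_fin ler_wpM2r ?expR_ge0//.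
    by rewrite lerDl sumr_ge0// => i _; exact: expR_ge0.
  apply: (@le_trans _ _ 1%:E).
    have [p0 _] := andP (p01 j); rewrite -(fineK (pfin j)) in p0 *.
    by move: p0; rewrite -EFinB !lee_fin; lra.
  rewrite lee_fin.
  apply: (@le_trans _ _ (expR (c * (n j)%:R) * expR (- (c * (n j)%:R)))).
    by rewrite -expRD subrr expR0.
  rewrite ler_wpM2r ?expR_ge0// /C' (bigD1 (Ordinal jJ))//= addrCA lerDl.
  by rewrite addr_ge0 ?(ltW C0)// sumr_ge0// => i _; exact: expR_ge0.
split; last by exists C', c.
have e0 : (1 - C' * expR (- (c * (n j)%:R)))%:E @[j --> \oo] --> 1%E.
  apply: cvg_EFin; first by near=> j.
  rewrite -[X in _ --> X]subr0 -(mulr0 C').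
  apply: cvgB; first exact: cvg_cst.
  apply: cvgMr.
  apply: (cvg_comp (fun j => c * (n j)%:R) (fun x : R => expR (- x)));
    last exact: cvgr_expR.
  have nR : ((n j)%:R : R) @[j --> \oo] --> +oo by exact/cvgrnyP.
  have cy : c * x @[x --> +oo%R] --> +oo%R by exact: (gt0_cvgMry c0 cvg_id).
  exact: (cvg_comp _ _ nR cy).
apply: squeeze_cvge e0 (cvg_cst _); near=> j.
have /andP[p0 p1] := p01 j; rewrite p1 andbT.
by have := bound j; rewrite -(fineK (pfin j)) -EFinB !lee_fin; lra.
Unshelve. all: by end_near.
Qed.

(** The generating function bound at [s = k/N], in exponential form. *)
Lemma card_net_mul_expR (k n N q : nat) (h c : R) :
    (0 < k <= N)%N -> (0 < n)%N ->
    k%:R / n%:R * (ln (N%:R / k%:R) + (q%:R * ln 2 + 2)) <= h / 2 - c ->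
  #|net N k (k * q)|%:R * expR (- (n%:R / 2 * h)) <= expR (- (c * n%:R)).
Proof.
move=> /andP[k0 kN] n0 H.
have N0 : (0 < N)%N by apply: leq_trans kN.
have [kR NR nR] : [/\ 0 < k%:R :> R, 0 < N%:R :> R & 0 < n%:R :> R] by rewrite !ltr0n.
have s01 : 0 < (k%:R / N%:R : R) <= 1.
  by rewrite divr_gt0//= ler_pdivrMr// mul1r ler_nat.
apply: le_trans (ler_wpM2r (expR_ge0 _) (@card_net R N k (k * q) _ s01)) _.
have -> : 2 * (k%:R / N%:R) * N%:R = 2 * k%:R :> R by rewrite -mulrA divfK// gt_eqF.
rewrite invf_div.
have Nk : 0 < N%:R / k%:R :> R by rewrite divr_gt0.
rewrite -[N%:R / k%:R]lnK ?posrE// -[2 ^+ _](@lnK R) ?posrE ?exprn_gt0//.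
rewrite -expRM_natl -!expRD ler_expR lnXn// -[ln 2 *+ _]mulr_natl natrM.
move: H; rewrite -(ler_pM2r nR) => H.
apply: le_trans (_ : k%:R / n%:R * (ln (N%:R / k%:R) + (q%:R * ln 2 + 2)) *
  n%:R - n%:R / 2 * h <= _).
  by rewrite le_eqVlt; apply/orP; left; apply/eqP; field; rewrite gt_eqF.
by lra.
Qed.

End ExponentialConvergence.

(** * The two restricted isometry constants *)

Section Assembly.
Context {R : realType}.

Lemma net_entropy_cvg (k n N : nat -> nat) (delta r C : R) :
    (forall j, (0 < k j)%N /\ (k j <= n j <= N j)%N) -> 0 < delta -> 0 < r ->
    ((n j)%:R / (N j)%:R : R) @[j --> \oo] --> delta ->
    ((k j)%:R / (n j)%:R : R) @[j --> \oo] --> r ->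
  (k j)%:R / (n j)%:R * (ln ((N j)%:R / (k j)%:R) + C) @[j --> \oo] -->
    r * (ln (1 / (delta * r)) + C).
Proof.
move=> knN d0 r0 cd cr; apply: cvgM => //; apply: cvgD; last exact: cvg_cst.
have -> : (fun j => ln ((N j)%:R / (k j)%:R) : R) =
    (fun x => ln (1 / x)) \o (fun j => (n j)%:R / (N j)%:R * ((k j)%:R / (n j)%:R) : R).
  apply/funext => j /=; congr ln; have [k0 /andP[kn nN]] := knN j.
  have nz (m : nat) : (0 < m)%N -> m%:R != 0 :> R by rewrite pnatr_eq0 -lt0n.
  by field; rewrite !nz//; do ?[exact: leq_trans kn|exact: leq_trans nN|exact: leq_trans (leq_trans kn nN)].
apply: cvg_comp; first by apply: cvgM; [exact: cd|exact: cr].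
have dr0 : 0 < delta * r by rewrite mulr_gt0.
apply: (@continuous_comp _ _ _ (fun x : R => 1 / x) (@ln R)).
  by apply: cvgM; [exact: cvg_cst|apply: cvgV => //; rewrite gt_eqF].
by apply: continuous_ln; rewrite div1r invr_gt0.
Qed.

(** The exponential rate obtained is half of the gap between [h / 2] and the
    limiting entropy of the net, which leaves room for the convergence of the
    entropy. *)
Lemma cvg1_exponentially_net (q : nat) (k n N : nat -> nat) (delta r h : R)
    (vs : seq R) (d : nat -> measure_display) (T : forall j, measurableType (d j))
    (P : forall j, probability (T j) R)
    (A : forall j, 'I_(n j) -> 'I_(N j) -> {RV (P j) >-> R})
    (E : forall j, set (T j)) :
    (forall j, (0 < k j)%N /\ (k j <= n j <= N j)%N) -> 0 < delta -> 0 < r ->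
    n j @[j --> \oo] --> \oo ->
    ((n j)%:R / (N j)%:R : R) @[j --> \oo] --> delta ->
    ((k j)%:R / (n j)%:R : R) @[j --> \oo] --> r ->
    (forall j, iid_gaussian (A j)) ->
    r * (ln (1 / (delta * r)) + (q%:R * ln 2 + 2)) < h / 2 ->
    (forall v, v \in vs -> 0 < v /\ h <= chi2_rate v) ->
    (forall j, measurable (E j)) ->
    (forall j w, ~ E j w ->
      exists2 v, v \in vs & exists2 f, f \in net (N j) (k j) (k j * q) &
      0 < (v - 1) * (norm2 (sample_mx (A j) w *m net_vector f) ^+ 2 -
                     v * norm2 (net_vector f : 'cV[R]_(N j)) ^+ 2)) ->
  @cvg1_exponentially R n (fun j => P j (E j)).
Proof.
move=> knN d0 r0 noo cd cr iidA rh vsP mE EP.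
set L := r * _ in rh; pose c := (h / 2 - L) / 2.
have c0 : 0 < c by rewrite /c; lra.
have near_entropy := @net_entropy_cvg k n N delta r (q%:R * ln 2 + 2) knN d0 r0 cd cr.
apply: (@cvg1_exponentially_of_near _ _ _ ((size vs)%:R + 1) c) => //.
- by move=> j; rewrite measure_ge0 probability_le1.
near=> j.
have [k0 /andP[kn nN]] := knN j.
have n0 : (0 < n j)%N by apply: leq_trans kn.
apply: le_trans (net_union_bound n0 (iidA j) (mE j) vsP (EP j)) _.
rewrite lee_fin -mulrA; apply: ler_pM; rewrite ?mulr_ge0 ?expR_ge0 ?lerDl//.
apply: card_net_mul_expR => //; first by rewrite k0 (leq_trans kn).
apply: ltW; near: j; apply: (cvgr_lt L) => //.
by rewrite /c; lra.
Unshelve. all: by end_near. Qed.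

Lemma ric_upper_cvg1 (q : nat) (k n N : nat -> nat) (delta r h v b : R)
    (d : nat -> measure_display) (T : forall j, measurableType (d j))
    (P : forall j, probability (T j) R)
    (A : forall j, 'I_(n j) -> 'I_(N j) -> {RV (P j) >-> R}) :
    (forall j, (0 < k j)%N /\ (k j <= n j <= N j)%N) -> 0 < delta -> 0 < r ->
    n j @[j --> \oo] --> \oo ->
    ((n j)%:R / (N j)%:R : R) @[j --> \oo] --> delta ->
    ((k j)%:R / (n j)%:R : R) @[j --> \oo] --> r ->
    (forall j, iid_gaussian (A j)) ->
    r * (ln (1 / (delta * r)) + (q%:R * ln 2 + 2)) < h / 2 ->
    (4 <= q)%N -> 1 < v -> h <= chi2_rate v -> v * (1 + 4 / q%:R) - 1 < b ->
  cvg1_exponentially n (fun j =>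
    P j [set w | ric_upper (k j) (sample_mx (A j) w) < b]).
Proof.
move=> knN d0 r0 noo cd cr iidA ent q4 v1 hv vb.
have v0 : 0 < v := lt_trans ltr01 v1.
have pos j : (0 < k j)%N /\ (0 < N j)%N.
  have [k0 /andP[kn nN]] := knN j.
  by split => //; exact: leq_trans (leq_trans k0 kn) nN.
apply: (cvg1_exponentially_net (vs := [:: v]) knN d0 r0 noo cd cr iidA ent).
- by move=> _ /[!inE] /eqP ->.
- by move=> j; have [k0 N0] := pos j; exact: measurable_ric_upper_lt.
move=> j w; have [k0 N0] := pos j; set B := sample_mx _ _ => Ew.
apply: contrapT => no; apply: Ew => /=.
have up f : f \in net (N j) (k j) (k j * q) ->
    norm2 (B *m net_vector f) ^+ 2 <= v * norm2 (net_vector f) ^+ 2.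
  move=> fn; rewrite leNgt; apply/negP => lt_v; apply: no.
  exists v; first by rewrite inE.
  by exists f => //; rewrite mulr_gt0 ?subr_gt0.
rewrite /ric_upper; apply: le_lt_trans vb; rewrite lerD2r.
exact: sup_rayleigh_net k0 N0 q4 (ltW v0) up.
Qed.

(** The hypothesis [h <= 1] ensures that the threshold [4] for the upper tail
    also beats the entropy. *)
Lemma ric_lower_cvg1 (q : nat) (k n N : nat -> nat) (delta r h v b : R)
    (d : nat -> measure_display) (T : forall j, measurableType (d j))
    (P : forall j, probability (T j) R)
    (A : forall j, 'I_(n j) -> 'I_(N j) -> {RV (P j) >-> R}) :
    (forall j, (0 < k j)%N /\ (k j <= n j <= N j)%N) -> 0 < delta -> 0 < r ->
    n j @[j --> \oo] --> \oo ->
    ((n j)%:R / (N j)%:R : R) @[j --> \oo] --> delta ->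
    ((k j)%:R / (n j)%:R : R) @[j --> \oo] --> r ->
    (forall j, iid_gaussian (A j)) ->
    r * (ln (1 / (delta * r)) + (q%:R * ln 2 + 2)) < h / 2 ->
    (4 <= q)%N -> 0 < v < 1 -> h <= chi2_rate v -> h <= 1 ->
    1 - v + 11 / q%:R < b ->
  cvg1_exponentially n (fun j =>
    P j [set w | ric_lower (k j) (sample_mx (A j) w) < b]).
Proof.
move=> knN d0 r0 noo cd cr iidA ent q4 /andP[v0 v1] hv h1 vb.
have pos j : (0 < k j)%N /\ (0 < N j)%N.
  have [k0 /andP[kn nN]] := knN j.
  by split => //; exact: leq_trans (leq_trans k0 kn) nN.
have q0 : 0 < q%:R :> R by rewrite ltr0n; apply: leq_trans q4.
apply: (cvg1_exponentially_net (vs := [:: 4; v]) knN d0 r0 noo cd cr iidA ent).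
- move=> _ /[!inE] /orP[] /eqP ->; split => //.
  exact: le_trans h1 chi2_rate4.
- by move=> j; have [k0 N0] := pos j; exact: measurable_ric_lower_lt.
move=> j w; have [k0 N0] := pos j; set B := sample_mx _ _ => Ew.
apply: contrapT => no; apply: Ew => /=.
have up f : f \in net (N j) (k j) (k j * q) ->
    norm2 (B *m net_vector f) ^+ 2 <= 4 * norm2 (net_vector f) ^+ 2.
  move=> fn; rewrite leNgt; apply/negP => lt4; apply: no.
  exists 4; first by rewrite !inE eqxx.
  by exists f => //; rewrite mulr_gt0 ?subr_gt0// ltr1n.
have lo f : f \in net (N j) (k j) (k j * q) ->
    v * norm2 (net_vector f) ^+ 2 <= norm2 (B *m net_vector f) ^+ 2.
  move=> fn; rewrite leNgt; apply/negP => lt_v; apply: no.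
  exists v; first by rewrite !inE eqxx orbT.
  by exists f => //; rewrite nmulr_rgt0 ?subr_lt0.
have S8 : sup (rayleigh_quotients (k j) B) <= 8.
  apply: le_trans (sup_rayleigh_net k0 N0 q4 _ up) _ => //.
  have : 4 / q%:R <= 1 :> R by rewrite ler_pdivrMr// mul1r ler_nat.
  by clear; lra.
have I_ge := inf_rayleigh_net k0 N0 q4 (ltW v0) (ler0n R 8) S8 lo.
have v11 : (3 * v + 8) / q%:R <= 11 / q%:R.
  by rewrite ler_pM2r ?invr_gt0//; move: v1; clear; lra.
by move: I_ge v11 vb; clear; rewrite /ric_lower; lra.
Qed.

(** On the range considered both bounds increase with [bound_arg], and they move in the favourable direction
    when [cu] is lowered to [min cu 1] and [cl] raised to [max cl 0], so it
    suffices to treat these constants at [bound_arg = 4 / gamma = a^2].  The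
    threshold on [gamma] only expresses that [a] is small. *)
Lemma rates_exceed_entropy (cu cl : R) : 1 / 3 < cu -> cl < 1 / 3 ->
  exists2 gamma0 : R, 4 <= gamma0 & forall gamma, gamma0 < gamma ->
  exists u l : R, [/\ 0 < u, 0 < l < 1,
    2 / gamma < chi2_rate (1 + u), 2 / gamma < chi2_rate (1 - l) &
    forall delta, 4 / gamma <= bound_arg gamma delta <= 9 / 4 ->
      u <= Utilde cu gamma delta /\ l <= Ltilde cl gamma delta].
Proof.
move=> hcu hcl; pose c1 := Num.min cu 1; pose c2 := Num.max cl 0.
have c1b : 1 / 3 < c1 <= 1 by rewrite lt_min hcu ge_min lexx orbT andbT; lra.
have c2b : 0 <= c2 < 1 / 3 by rewrite le_max lexx orbT gt_max hcl; lra.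
have [a1 /andP[a10 a11] rate1] := chi2_rate_upper c1b.
have [a2 /andP[a20 a21] rate2] := chi2_rate_lower c2b.
pose m := Num.min a1 a2.
have m0 : 0 < m by rewrite lt_min a10.
have m1 : m <= 1 by rewrite ge_min a11.
have m4 : 4 <= 4 / m ^+ 2.
  by rewrite ler_pdivlMr ?exprn_gt0// ler_piMr// exprn_ile1// ltW.
(* [gamma > 4 / m^2] means [a < m] *)
exists (4 / m ^+ 2) => // gamma gg.
have g0 : 0 < gamma by move: m4 gg; clear; lra.
pose a := Num.sqrt (4 / gamma).
have a0 : 0 < a by rewrite sqrtr_gt0 divr_gt0.
have aa : a ^+ 2 = 4 / gamma by rewrite sqr_sqrtr// divr_ge0// ltW.
have am : a < m.
  rewrite -(@ltr_pXn2r _ 2) ?nnegrE ?(ltW a0) ?(ltW m0)// aa.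
  by rewrite ltr_pdivrMr// mulrC -ltr_pdivrMr ?exprn_gt0.
have /andP[aa1 aa2] : (a < a1) && (a < a2) by rewrite -lt_min.
have half_aa : 2 / gamma = a ^+ 2 / 2 by rewrite aa; field; rewrite gt_eqF.
have a_lt1 : a < 1 := lt_le_trans aa1 a11.
exists (a + c1 * a ^+ 2), (a - c2 * a ^+ 2); split.
- by move: a0 c1b; clear; nra.
- by move: a0 a_lt1 c2b; clear; move=> *; apply/andP; split; nra.
- by rewrite half_aa rate1// a0.
- by rewrite half_aa rate2// a0.
move=> delta /andP[x_ge x_le]; rewrite aa; split.
  apply: Utilde_ge => //; rewrite ge_min lexx andbT.
  by move: c1b; clear; lra.
apply: Ltilde_ge => //; last by rewrite x_ge.
  by rewrite le_max lexx.
by move: c2b => /andP[-> /ltW ->].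
Qed.

(** Both the entropy of the net and [bound_arg] differ from their limits
    [1 / gamma] and [4 / gamma] by multiples of [(ln y + C) / y], where
    [y = gamma ln (1/delta)] tends to infinity. *)
Lemma small_delta (gamma h C : R) : 4 < gamma -> 2 / gamma < h ->
  exists2 delta0, 0 < delta0 & forall delta, 0 < delta -> delta < delta0 ->
  [/\ 0 < rho gamma delta,
    rho gamma delta * (ln (1 / (delta * rho gamma delta)) + C) < h / 2 &
    4 / gamma <= bound_arg gamma delta <= 9 / 4].
Proof.
move=> g4 hh; have g0 : 0 < gamma by lra.
have e1 : 0 < h / 2 - 1 / gamma by lra.
have [M1 M11 small1] := small_ln_div C e1.
(* [1 + 6 * (5/24) = 9/4] *)
have [|M2 M21 small2] := @small_ln_div R 1 (5 / 24); first lra.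
have [delta0 delta00 large] := ln_inv_large (Num.max M1 M2) g0.
exists delta0 => // delta d0 dd0.
have := large delta d0 dd0; rewrite gt_max => /andP[My1 My2].
have y1 : 1 < gamma * ln (delta^-1) by apply: le_lt_trans My1.
have [_ r0 entE] := rho_ln g0 d0 y1; split => //.
  by rewrite entE; have := small1 _ My1; clear; lra.
rewrite (bound_argE g0 d0 y1); apply/andP; split.
  rewrite lerDl mulr_ge0// divr_ge0 ?addr_ge0 ?ln_ge0// ltW// .
  exact: lt_trans y1.
have g1 : 4 / gamma < 1 by rewrite ltr_pdivrMr// mul1r.
by have := small2 _ My2; move: g1; clear; lra.
Qed.

End Assembly.

Theorem theorem4 (R : realType) (cu cl : R) (hcu : 1 / 3 < cu) (hcl : cl < 1 / 3) :
  exists gamma0 : R, 4 <= gamma0 /\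
  forall gamma eps : R, gamma0 < gamma -> 0 < eps ->
  exists delta0 : R, 0 < delta0 /\
  forall delta : R, 0 < delta < 1 -> delta < delta0 ->
  forall k n N : nat -> nat,
    (forall j, (0 < k j)%N /\ (k j <= n j <= N j)%N) ->
    n j @[j --> \oo] --> \oo ->
    ((n j)%:R / (N j)%:R : R) @[j --> \oo] --> delta ->
    ((k j)%:R / (n j)%:R : R) @[j --> \oo] --> rho gamma delta ->
  forall (d : nat -> measure_display) (T : forall j, measurableType (d j))
    (P : forall j, probability (T j) R)
    (A : forall j, 'I_(n j) -> 'I_(N j) -> {RV (P j) >-> R}),
    (forall j, iid_gaussian (A j)) ->
  cvg1_exponentially n (fun j =>
    P j [set w | ric_lower (k j) (sample_mx (A j) w)
                 < Ltilde cl gamma delta + eps]) /\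
  cvg1_exponentially n (fun j =>
    P j [set w | ric_upper (k j) (sample_mx (A j) w)
                 < Utilde cu gamma delta + eps]).
Proof.
have [gamma0 gamma04 rates] := rates_exceed_entropy hcu hcl.
exists gamma0; split=> // gamma eps gg e0.
have [u [l [u0 /andP[l0 l1] hu hl dominate]]] := rates gamma gg.
have g4 : 4 < gamma := le_lt_trans gamma04 gg.
have g0 : 0 < gamma := lt_trans (ltr0n R 4) g4.
pose h := Num.min (chi2_rate (1 + u)) (Num.min (chi2_rate (1 - l)) 1).
have hh : 2 / gamma < h.
  by rewrite !lt_min hu hl /= ltr_pdivrMr// mul1r (lt_trans _ g4)// ltr_nat.
have [hvu hvl h1] :
    [/\ h <= chi2_rate (1 + u), h <= chi2_rate (1 - l) & h <= 1].
  by rewrite !ge_min !lexx ?orbT.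
have [q q4 Kq] := exists_net_resolution (4 * (1 + u) + 11) e0.
have q0 : 0 < q%:R :> R by rewrite ltr0n; apply: leq_trans q4.
have [delta0 delta00 small] := small_delta (q%:R * ln 2 + 2) g4 hh.
exists delta0; split => // delta /andP[d0 _] dd0 k n N knN noo cd cr d T P A iidA.
have [r0 ent xb] := small delta d0 dd0.
have [Uu Ll] := dominate delta xb.
have [Ku Kl] : 4 * (1 + u) / q%:R < eps /\ 11 / q%:R < eps.
  by split; apply: le_lt_trans Kq; rewrite ler_pM2r ?invr_gt0//;
    move: u0; clear; lra.
split.
- apply: (ric_lower_cvg1 knN d0 r0 noo cd cr iidA ent q4 _ hvl h1).
    by rewrite subr_gt0 l1 gtrBl.
  by move: Ll Kl; clear; lra.
- apply: (ric_upper_cvg1 knN d0 r0 noo cd cr iidA ent q4 _ hvu).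
    by rewrite ltrDl.
  have -> : (1 + u) * (1 + 4 / q%:R) = 1 + u + 4 * (1 + u) / q%:R by ring.
  by move: Uu Ku; clear; lra.
Qed.
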